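(* For even integers $m\geq 2$, $$\int_0^1 \frac{(x^2+1)\log \left(x^{4 m}+1\right)}{x^4+1}\,dx=\frac{m}{16}\left(\psi'(7/8)-\psi'(3/8)\right)-\frac{\pi^2m\sqrt{2}}{8}+\frac{\pi m\sqrt{2}}{4}\log 2+\frac{\pi\sqrt{2}}{4}\Bigg\{\sum_{k=0}^{\frac{m}{2}-1}\log\left(1+\sqrt{\frac{1-\varphi_k}{2}}\right)+2\sum_{k=0}^{\frac{m}{2}-1}\log\left(\sqrt{2}+\sqrt{1+\sqrt{\frac{1-\varphi_k}{2}}}\right)\Bigg\},$$ and for odd integers $m\geq 1$, $$\int_0^1 \frac{(x^2+1)\log \left(x^{4 m}+1\right)}{x^4+1}\,dx=\frac{m}{16}\left(\psi'(7/8)-\psi'(3/8)\right)-\frac{\pi^2m\sqrt{2}}{8}+\frac{\pi (m+2)\sqrt{2}}{4}\log 2+\frac{\pi\sqrt{2}}{4}\Bigg\{\sum_{k=0}^{\frac{m-3}{2}}\log\left(1+\sqrt{\frac{1-\varphi_k}{2}}\right)+2\sum_{k=0}^{\frac{m-3}{2}}\log\left(\sqrt{2}+\sqrt{1+\sqrt{\frac{1-\varphi_k}{2}}}\right)\Bigg\},$$ where $\varphi_k=\cos\left(\frac{(2k+1)\pi}{m}\right)$.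
   Context: $\psi=\Gamma'/\Gamma$ is the digamma function and $\psi'$ its derivative. An empty sum $\sum_{k=0}^{-1}(\cdot)$ is taken to be zero. *)

(* Defs.v *)
From Stdlib Require Import Reals.
From Coquelicot Require Import Coquelicot.
From mathcomp Require Import bigop.

Open Scope R_scope.

(* Euler's integral; it converges exactly when 0 < x, the only range in which
   Gamma is the Gamma function. *)
Definition Gamma (x : R) : R :=
  RInt_gen (fun t => Rpower t (x - 1) * exp (- t))
    (at_right 0) (Rbar_locally p_infty).

Definition digamma (x : R) : R := Derive Gamma x / Gamma x.

Definition trigamma (x : R) : R := Derive digamma x.

Definition phi (m k : nat) : R := cos ((2 * INR k + 1) * PI / INR m).

(* The sum over 0 <= k < n, that is k = 0, ..., n - 1; it is 0 for n = 0. *)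
Definition Rsum (n : nat) (f : nat -> R) : R :=
  \big[Rplus/0]_(0 <= k < n) f k.

(* Main.v *)
(* Write x^(4m) + 1 = prod_k ((1 - x^2)^2 + a_k^2 x^2) with
   a_k = 2 sin ((2k+1) pi / (4m)), and substitute theta with theta(0) = 0, theta(1) = pi
   and theta' = 2 sqrt 2 (1 + x^2)/(1 + x^4).
   In the variable theta each factor is, up to 1 + x^4 and a constant, a Poisson
   kernel 1 - 2 r cos theta + r^2 with |r| < 1, whose logarithm integrates to 0 over
   [0, pi].  So the integral K(a) attached to a factor is
   J + (pi / sqrt 2) log (sqrt 2 + a) with J independent of a, and letting a tend to
   infinity identifies J as 2 int_0^1 (1 + x^2) log x / (1 + x^4) dx.  That integral
   splits into 4 int x^2 log x / (1 + x^4), a geometric series which sums to trigamma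
   values, and 2 int (1 - x^2) log x / (1 + x^4) = - pi^2 / (4 sqrt 2), obtained by
   parts and differentiation under the integral sign.  The factors k and m - 1 - k
   then pair up into the stated closed form.

   The trigamma series comes from the bound Gamma (x + h) <= x^h Gamma x for
   0 <= h <= 1, which determines log Gamma (and its derivatives) as a limit in the
   manner of Bohr and Mollerup. *)

Require Import Defs.
From Stdlib Require Import Reals Lra Lia.
From Coquelicot Require Import Coquelicot.
From mathcomp Require ssreflect ssrfun ssrbool eqtype ssrnat seq bigop order ssralg ssrnum poly Rstruct.

Open Scope R_scope.

(** The angles come from Chebyshev polynomials: with y = x^2, x^(4m) + 1 = y^m (y^m + y^(-m)), and
    y^m + y^(-m) is 2 T_m evaluated at (y + 1/y) / 2, which vanishes when y + 1/y is 2 cos of some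
    [cheb_angle m k]; halving that angle turns 2 - 2 cos into a_k^2. The obstacle in computing J is
    that the limit integrand has a logarithm unbounded at 0 and so is not Riemann integrable there.
    The limit is therefore taken along cut-offs e = d^2 with d -> 0: the square makes every error of
    the shape e log e at most a multiple of d, because |d log d| <= 1. Writing 1 + x^2 = 2 x^2 + (1
    - x^2) separates a part continuous at 0 from a part that stays truncated. On the Gamma side,
    [RInt_gen] and [Derive] are total, so each integral and derivative must be shown to exist before
    its value carries information. Derivatives of limits are read off quadratic error bounds that
    hold for every partial sum and pass to the limit, so no uniform convergence is involved. *)

(** * Factoring x^(4m) + 1 through Chebyshev polynomials *)

Definition cheb_angle (m k : nat) : R := (2 * INR k + 1) * PI / (2 * INR m).

Lemma cheb_angle_bounds (m k : nat) : (k < m)%nat -> 0 <= cheb_angle m k <= PI.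
Proof.
  intros Hk. assert (HP := PI_RGT_0). assert (Hk0 := pos_INR k).
  assert (H : INR (S k) <= INR m) by (now apply le_INR). rewrite S_INR in H.
  unfold cheb_angle. split.
  - apply Rmult_le_pos; [nra|]. left. apply Rinv_0_lt_compat. lra.
  - apply Rmult_le_reg_r with (2 * INR m); [lra|].
    unfold Rdiv. rewrite Rmult_assoc, Rinv_l by lra. nra.
Qed.

Lemma cos_mul_cheb_angle (m k : nat) : (0 < m)%nat -> cos (INR m * cheb_angle m k) = 0.
Proof.
  intros Hm. apply lt_INR in Hm. simpl in Hm.
  apply cos_eq_0_1. exists (Z.of_nat k). rewrite <- INR_IZR_INZ.
  unfold cheb_angle. field. lra.
Qed.

Lemma cos_cheb_angle_inj (m i j : nat) : (i < m)%nat -> (j < m)%nat ->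
  cos (cheb_angle m i) = cos (cheb_angle m j) -> i = j.
Proof.
  intros Hi Hj H.
  assert (E : cheb_angle m i = cheb_angle m j).
  { rewrite <- (acos_cos (cheb_angle m i)), <- (acos_cos (cheb_angle m j))
      by now apply cheb_angle_bounds. now rewrite H. }
  assert (Hm : 0 < INR m) by (apply (lt_INR 0); lia).
  assert (HP := PI_RGT_0). unfold cheb_angle in E. apply INR_eq.
  apply Rmult_eq_compat_r with (r := INR m / PI) in E.
  replace ((2 * INR i + 1) * PI / (2 * INR m) * (INR m / PI)) with (INR i + / 2) in E by (field; lra).
  replace ((2 * INR j + 1) * PI / (2 * INR m) * (INR m / PI)) with (INR j + / 2) in E by (field; lra).
  lra.
Qed.

Module ChebyshevFactorization.

Import ssreflect ssrfun ssrbool eqtype ssrnat seq bigop order ssralg ssrnum poly Rstruct.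
Import GRing.Theory Num.Theory.

Lemma big_nat_Rplus (n : nat) (f : nat -> R) :
  Rsum n f = (\sum_(0 <= k < n) f k)%R.
Proof. by []. Qed.

Lemma Rsum_0 (f : nat -> R) : Rsum 0 f = 0.
Proof. by rewrite big_nat_Rplus big_geq. Qed.

Lemma Rsum_S (n : nat) (f : nat -> R) : Rsum n.+1 f = Rplus (Rsum n f) (f n).
Proof. by rewrite big_nat_Rplus big_nat_recr. Qed.

Lemma Rsum_split (a b : nat) (f : nat -> R) :
  Rsum (a + b) f = Rplus (Rsum a f) (Rsum b (fun k => f (a + k)%N)).
Proof.
rewrite !big_nat_Rplus (@big_cat_nat _ _ _ a) ?leq_addr //=; congr Rplus.
by rewrite -{1}[a]addn0 [X in (\sum_(X <= _ < _) _)%R]addnC big_addn addKn;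
   apply: eq_bigr => i _; rewrite addnC.
Qed.

Lemma Rsum_rev (n : nat) (f : nat -> R) :
  Rsum n f = Rsum n (fun k => f (n - S k)%coq_nat).
Proof.
rewrite !big_nat_Rplus big_nat_rev /=.
by apply: eq_bigr => i _; rewrite add0n.
Qed.

(* [cheb n] is [2 T_n(X / 2)]: it maps [y + 1/y] to [y^n + 1/y^n]. *)
Fixpoint cheb (n : nat) : {poly R} :=
  match n with
  | 0 => (2 : R)%:P%R
  | n'.+1 => match n' with
    | 0 => 'X%R
    | n''.+1 => ('X * cheb n' - cheb n'')%R
    end
  end.

Lemma chebSS (n : nat) : cheb n.+2 = ('X * cheb n.+1 - cheb n)%R.
Proof. by []. Qed.

(** The size bound on [cheb n] ensures that subtracting it in the recursion disturbs neither the
    degree nor the leading coefficient of ['X * cheb n.+1]. Monicity starts at index 1 because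
    [cheb 0] is the constant 2. *)
Lemma cheb_monic (n : nat) :
  [/\ size (cheb n.+1) = n.+2, cheb n.+1 \is monic & (size (cheb n) <= n.+1)%N].
Proof.
elim: n => [|n [IHs IHm IHl]].
  by rewrite /= size_polyX monicX size_polyC; split => //; case: (_ != _).
have nz : (cheb n.+1 != 0)%R by rewrite -size_poly_eq0 IHs.
have sz : size ('X * cheb n.+1)%R = n.+3 by rewrite mulrC size_mulX // IHs.
have lt : (size (- cheb n)%R < size ('X * cheb n.+1)%R)%N.
  by rewrite size_polyN sz ltnS (leq_trans IHl).
rewrite chebSS; split; last by rewrite IHs.
- by rewrite size_polyDl.
- by rewrite monicE lead_coefDl // lead_coefM lead_coefX mul1r -monicE.
Qed.

Lemma horner_cheb_cos (n : nat) (t : R) :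
  ((cheb n).[(Rmult (IZR 2) (cos t))])%R = (2 * cos (INR n * t)).
Proof.
suff: ((cheb n).[(Rmult (IZR 2) (cos t))])%R = (2 * cos (INR n * t)) /\
      ((cheb n.+1).[(Rmult (IZR 2) (cos t))])%R = (2 * cos (INR n.+1 * t)) by case.
elim: n => [|n [IH1 IH2]].
  rewrite /= hornerC hornerX !Rmult_0_l !Rmult_1_l cos_0; split => //.
  by rewrite Rmult_1_r.
split=> //.
have E : 2 * cos t * (2 * cos (INR n.+1 * t)) - 2 * cos (INR n * t) = 2 * cos (INR n.+2 * t).
  have -> : (INR n.+2 * t = INR n.+1 * t + t) by rewrite (S_INR n.+1); ring.
  have -> : (INR n * t = INR n.+1 * t - t) by rewrite (S_INR n); ring.
  rewrite cos_plus cos_minus; ring.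
by rewrite -E chebSS hornerD hornerN hornerM hornerX IH1 IH2.
Qed.

Lemma horner_cheb_inv (n : nat) (y : R) : y <> 0 ->
  ((cheb n).[(Rplus y (Rinv y))])%R = (pow y n + / pow y n).
Proof.
move=> y0.
suff: ((cheb n).[(Rplus y (Rinv y))])%R = (pow y n + / pow y n) /\
      ((cheb n.+1).[(Rplus y (Rinv y))])%R = (pow y n.+1 + / pow y n.+1) by case.
elim: n => [|n [IH1 IH2]].
  rewrite /= hornerC hornerX Rmult_1_r Rinv_1; split => //.
split=> //.
have E : (y + / y) * (y ^ n.+1 + / y ^ n.+1) - (y ^ n + / y ^ n) = y ^ n.+2 + / y ^ n.+2.
  by rewrite /=; field; split => //; exact: pow_nonzero.
by rewrite -E chebSS hornerD hornerN hornerM hornerX IH1 IH2.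
Qed.

(** A monic polynomial of degree m with m distinct roots is the product of its linear factors. The
    roots come from [cos_mul_cheb_angle], their distinctness from the injectivity of cosine on
    [0, pi]. *)
Lemma cheb_prod (m : nat) : (0 < m)%N ->
  cheb m = (\prod_(0 <= k < m) ('X - (Rmult (IZR 2) (cos (cheb_angle m k)))%:P))%R.
Proof.
case: m => // m _; set rs := [seq (2 * cos (cheb_angle m.+1 k)) | k <- index_iota 0 m.+1].
have [sz mon _] := cheb_monic m.
rewrite -(big_map (fun k => (2 * cos (cheb_angle m.+1 k))) xpredT
  (fun z => 'X - z%:P)%R) -/rs.
rewrite [LHS](@all_roots_prod_XsubC _ (cheb m.+1) rs).
- by rewrite (monicP mon) scale1r.
- by rewrite sz size_map size_iota subn0.
- apply/allP => _ /mapP[k _ ->]; rewrite rootE horner_cheb_cos.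
  by rewrite cos_mul_cheb_angle ?Rmult_0_r //; apply/ltP.
- rewrite uniq_rootsE map_inj_in_uniq ?iota_uniq // => i j.
  rewrite !mem_index_iota => /andP[_ /ltP ltim] /andP[_ /ltP ltjm] eqc.
  apply: (cos_cheb_angle_inj _ _ _ ltim ltjm).
  exact: (Rmult_eq_reg_l _ _ _ eqc (not_eq_sym (Rlt_not_eq _ _ Rlt_0_2))).
Qed.

Definition Rprod (n : nat) (f : nat -> R) : R := (\prod_(0 <= k < n) f k)%R.

Lemma Rprod_0 (f : nat -> R) : Rprod 0 f = IZR 1.
Proof. by rewrite /Rprod big_geq. Qed.

Lemma Rprod_S (n : nat) (f : nat -> R) : Rprod n.+1 f = Rmult (Rprod n f) (f n).
Proof. by rewrite /Rprod big_nat_recr. Qed.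

Lemma pow_add_inv_prod (m : nat) (y : R) : (0 < m)%coq_nat -> y <> IZR 0 ->
  (pow y m + / pow y m) =
  Rprod m (fun k => y + / y - 2 * cos (cheb_angle m k)).
Proof.
move=> /ltP m0 y0; rewrite -horner_cheb_inv // cheb_prod // horner_prod.
by apply: eq_bigr => k _; rewrite hornerXsubC.
Qed.

End ChebyshevFactorization.
Import ChebyshevFactorization.

(** * Finite sums and the logarithm of the factorization *)

Lemma Rsum_ext (n : nat) (f g : nat -> R) :
  (forall k, (k < n)%nat -> f k = g k) -> Rsum n f = Rsum n g.
Proof.
  induction n as [|n IH]; intros H; [now rewrite !Rsum_0|].
  rewrite !Rsum_S, IH, H; auto.
Qed.

Lemma Rsum_plus (n : nat) (f g : nat -> R) :
  Rsum n (fun k => f k + g k) = Rsum n f + Rsum n g.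
Proof. induction n as [|n IH]; rewrite ?Rsum_0, ?Rsum_S; lra. Qed.

Lemma Rsum_scal (n : nat) (c : R) (f : nat -> R) :
  Rsum n (fun k => c * f k) = c * Rsum n f.
Proof. induction n as [|n IH]; rewrite ?Rsum_0, ?Rsum_S; lra. Qed.

Lemma Rsum_le (n : nat) (f g : nat -> R) :
  (forall k, (k < n)%nat -> f k <= g k) -> Rsum n f <= Rsum n g.
Proof.
  induction n as [|n IH]; intros H; [rewrite !Rsum_0; lra|].
  rewrite !Rsum_S. apply Rplus_le_compat; auto.
Qed.

Lemma Rsum_nonneg (n : nat) (f : nat -> R) :
  (forall k, (k < n)%nat -> 0 <= f k) -> 0 <= Rsum n f.
Proof.
  induction n as [|n IH]; intros H; [rewrite !Rsum_0; lra|].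
  rewrite !Rsum_S. apply Rplus_le_le_0_compat; auto.
Qed.

Lemma ln_Rprod (n : nat) (f : nat -> R) : (forall k, (k < n)%nat -> 0 < f k) ->
  0 < Rprod n f /\ ln (Rprod n f) = Rsum n (fun k => ln (f k)).
Proof.
  induction n as [|n IH]; intros H.
  - rewrite Rprod_0, Rsum_0, ln_1. split; lra.
  - destruct IH as [H1 H2]; [auto|]. rewrite Rprod_S, Rsum_S, ln_mult, H2 by auto.
    split; [apply Rmult_lt_0_compat; auto|reflexivity].
Qed.

(** With y = x^2, the factor y^m of x^(4m) + 1 = y^m (y^m + y^(-m)) is shared out, one y to each
    Chebyshev factor, and y (y + 1/y - 2 cos t) = (1 - y)^2 + (2 sin (t/2))^2 y. *)
Lemma ln_pow_mul_add_1 (m : nat) (x : R) : (0 < m)%nat -> 0 < x ->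
  ln (x ^ (4 * m) + 1) =
  Rsum m (fun k => ln ((1 - x ^ 2) ^ 2 + (2 * sin (cheb_angle m k / 2)) ^ 2 * x ^ 2)).
Proof.
  intros Hm Hx. set (y := x ^ 2).
  assert (Hy : 0 < y) by (apply pow_lt; lra).
  assert (Hym : 0 < y ^ m) by (apply pow_lt; lra).
  assert (Hp : forall k, (k < m)%nat -> 0 < y + / y - 2 * cos (cheb_angle m k)).
  { intros k Hk. assert (H := cheb_angle_bounds m k Hk).
    assert (Hc : cos (cheb_angle m k) < 1).
    { rewrite <- cos_0. apply cos_decreasing_1; try lra.
      assert (HP := PI_RGT_0). assert (Hk0 := pos_INR k). apply lt_INR in Hm. simpl in Hm.
      unfold cheb_angle. apply Rdiv_lt_0_compat; nra. }
    assert (H2 : y * (y + / y - 2) = (y - 1) ^ 2) by (field; lra).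
    assert (0 <= y + / y - 2); [|lra].
    apply Rmult_le_reg_l with y; [assumption|]. rewrite H2, Rmult_0_r. apply pow2_ge_0. }
  destruct (ln_Rprod m _ Hp) as [H1 H2].
  rewrite <- (pow_add_inv_prod m y Hm (Rgt_not_eq _ _ Hy)) in H1, H2.
  replace (x ^ (4 * m) + 1) with (y ^ m * (y ^ m + / y ^ m)).
  2:{ unfold y. rewrite <- !pow_mult. replace (4 * m)%nat with (2 * m + 2 * m)%nat by lia.
      rewrite pow_add. field. apply pow_nonzero. lra. }
  rewrite ln_mult, H2 by assumption.
  assert (H3 : ln (y ^ m) = Rsum m (fun _ => ln y)).
  { clear -Hy. induction m as [|m IH].
    - rewrite Rsum_0. simpl. apply ln_1.
    - rewrite Rsum_S, <- IH. simpl. rewrite ln_mult; [ring|assumption|now apply pow_lt]. }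
  rewrite H3, <- Rsum_plus. apply Rsum_ext. intros k Hk.
  rewrite <- ln_mult by (auto || apply Hp, Hk). f_equal. fold y.
  replace (cheb_angle m k) with (2 * (cheb_angle m k / 2)) at 1 by field.
  rewrite cos_2a_sin. field. lra.
Qed.

(** * Euler's integral *)

Lemma ex_derive_continuous_R (f : R -> R) (x : R) : ex_derive f x -> continuous f x.
Proof. exact (ex_derive_continuous (K := R_AbsRing) (V := R_NormedModule) f x). Qed.

Lemma ex_RInt_pos (g : R -> R) (a b : R) :
  (forall t, 0 < t -> continuous g t) -> 0 < a -> 0 < b -> ex_RInt g a b.
Proof.
  intros Hc Ha Hb. apply (ex_RInt_continuous (V := R_CompleteNormedModule)).
  intros z [Hz _]. apply Hc. refine (Rlt_le_trans _ _ _ _ Hz).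
  now apply Rmin_glb_lt.
Qed.

(** For a nonnegative integrand the improper integral is the supremum of the integrals over compact
    intervals. The last conjunct, that it is the least upper bound, allows inequalities on Gamma to
    be checked on compact intervals. *)
Lemma is_RInt_gen_nonneg_bounded (g : R -> R) (M : R) :
  (forall t, 0 < t -> 0 <= g t) ->
  (forall t, 0 < t -> continuous g t) ->
  (forall a b, 0 < a -> a <= b -> RInt g a b <= M) ->
  exists l, is_RInt_gen g (at_right 0) (Rbar_locally p_infty) l /\
    (forall a b, 0 < a -> a <= b -> RInt g a b <= l) /\
    (forall M', (forall a b, 0 < a -> a <= b -> RInt g a b <= M') -> l <= M').
Proof.
  intros Hpos Hc HM.
  set (E := fun y => exists a b, 0 < a /\ a <= b /\ y = RInt g a b).
  destruct (completeness E) as [l [Hub Hlub]].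
  - exists M. intros y (a & b & Ha & Hab & ->). now apply HM.
  - exists (RInt g 1 1), 1, 1. repeat split; lra.
  - exists l.
    assert (Hle : forall a b, 0 < a -> a <= b -> RInt g a b <= l).
    { intros a b Ha Hab. apply Hub. exists a, b. auto. }
    split; [|split; [exact Hle|]].
    2:{ intros M' HM'. apply Hlub. intros y (a & b & Ha & Hab & ->). now apply HM'. }
    intros P [eps HP].
    assert (He : exists a b, 0 < a /\ a <= b /\ l - eps < RInt g a b).
    { apply Classical_Prop.NNPP. intros HN.
      assert (l <= l - eps); [|destruct eps; simpl in *; lra].
      apply Hlub. intros y (a & b & Ha & Hab & ->).
      apply Rnot_lt_le. intros Hlt. apply HN. now exists a, b. }
    destruct He as (a0 & b0 & Ha0 & Hab0 & Hl0).
    (* Every interval containing [a0, b0] has its integral between l - eps and l, since the added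
       pieces are nonnegative. *)
    apply (Filter_prod _ _ _ (fun a => 0 < a < a0) (fun b => b0 < b)).
    + exists (mkposreal a0 Ha0). intros y Hy Hy0.
      apply Rabs_def2 in Hy. unfold minus, plus, opp in Hy. simpl in Hy. lra.
    + exists b0. auto.
    + intros a b Ha Hb. simpl. exists (RInt g a b).
      assert (Hex : forall u v, 0 < u -> 0 < v -> ex_RInt g u v)
        by (intros; now apply ex_RInt_pos).
      split; [apply (RInt_correct (V := R_CompleteNormedModule)); apply Hex; lra|].
      apply HP. unfold ball; simpl; unfold AbsRing_ball, abs, minus, plus, opp; simpl.
      assert (RInt g a b <= l) by (apply Hle; lra).
      assert (H1 : RInt g a a0 + RInt g a0 b0 + RInt g b0 b = RInt g a b).
      { rewrite <- (RInt_Chasles g a b0 b) by (apply Hex; lra).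
        rewrite <- (RInt_Chasles g a a0 b0) by (apply Hex; lra). reflexivity. }
      assert (0 <= RInt g a a0).
      { apply RInt_ge_0; [lra|apply Hex; lra|]. intros; apply Hpos; lra. }
      assert (0 <= RInt g b0 b).
      { apply RInt_ge_0; [lra|apply Hex; lra|]. intros; apply Hpos; lra. }
      apply Rabs_def1; lra.
Qed.

Definition gamma_integrand (x t : R) : R := Rpower t (x - 1) * exp (- t).

Lemma gamma_integrand_pos (x t : R) : 0 < gamma_integrand x t.
Proof. apply Rmult_lt_0_compat; apply exp_pos. Qed.

Lemma continuous_gamma_integrand (x t : R) : 0 < t -> continuous (gamma_integrand x) t.
Proof.
  intros Ht. apply ex_derive_continuous_R.
  unfold gamma_integrand, Rpower. auto_derive. lra.
Qed.

Lemma ln_le_sub_1 (u : R) : 0 < u -> ln u <= u - 1.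
Proof.
  intros Hu. generalize (exp_ineq1_le (ln u)). rewrite exp_ln by assumption. lra.
Qed.

Lemma ln_div_pos (a b : R) : 0 < a -> 0 < b -> ln (a / b) = ln a - ln b.
Proof.
  intros Ha Hb. unfold Rdiv. rewrite ln_mult, ln_Rinv; try assumption.
  - ring.
  - now apply Rinv_0_lt_compat.
Qed.

(** The exponent x ln (1 + t) - t is largest at 1 + t = x; the tangent to the logarithm at that
    point gives the bound. *)
Lemma Rpower_exp_bounded (x t : R) :
  0 < x -> 0 < t ->
  Rpower (1 + t) x * exp (- t) <= exp (x * ln x + 1 - x).
Proof.
  intros Hx Ht. unfold Rpower. rewrite <- exp_plus.
  assert (H : ln ((1 + t) / x) <= (1 + t) / x - 1)
    by (apply ln_le_sub_1; apply Rdiv_lt_0_compat; lra).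
  rewrite ln_div_pos in H by lra.
  assert (H2 : x * (ln (1 + t) - ln x) <= x * ((1 + t) / x - 1))
    by (apply Rmult_le_compat_l; lra).
  replace (x * ((1 + t) / x - 1)) with (1 + t - x) in H2 by (field; lra).
  assert (H3 : x * ln (1 + t) + - t <= x * ln x + 1 - x) by lra.
  destruct H3 as [H3|H3]; [left; now apply exp_increasing|right; now rewrite H3].
Qed.

(* The majorant is a multiple of the derivative of [(t / (1 + t)) ^ x]. *)
Lemma RInt_gamma_integrand_le (x a b : R) :
  0 < x -> 0 < a -> a <= b ->
  RInt (gamma_integrand x) a b <= exp ((x + 1) * ln (x + 1) + 1 - (x + 1)) / x.
Proof.
  intros Hx Ha Hab. set (C := exp _).
  set (h := fun t => Rpower t x * Rpower (1 + t) (- x)).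
  set (dh := fun t => x * (Rpower t (x - 1) * Rpower (1 + t) (- x - 1))).
  assert (HC : 0 < C) by apply exp_pos.
  assert (Hd : is_RInt (fun t => C / x * dh t) a b (C / x * (h b - h a))).
  { apply (is_RInt_scal (V := R_NormedModule)).
    apply (is_RInt_derive (V := R_CompleteNormedModule)).
    - intros t Ht. rewrite Rmin_left, Rmax_right in Ht by lra.
      unfold h, dh, Rpower. auto_derive; [repeat split; lra|].
      replace (x * (exp ((x - 1) * ln t) * exp ((- x - 1) * ln (1 + t)))) with
        (x * (exp (x * ln t) * exp (- ln t) * (exp (- x * ln (1 + t)) * exp (- ln (1 + t))))).
      2:{ rewrite <- !exp_plus. do 2 f_equal. ring. }
      rewrite !exp_Ropp, !exp_ln by lra. field. lra.
    - intros t Ht. rewrite Rmin_left, Rmax_right in Ht by lra.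
      apply ex_derive_continuous_R.
      unfold dh, Rpower. auto_derive. lra. }
  apply Rle_trans with (C / x * (h b - h a)).
  - apply (is_RInt_le (gamma_integrand x) (fun t => C / x * dh t) a b); auto.
    + apply (RInt_correct (V := R_CompleteNormedModule)). apply ex_RInt_pos; try lra.
      intros; now apply continuous_gamma_integrand.
    + intros t Ht. unfold gamma_integrand, dh.
      replace (C / x * (x * (Rpower t (x - 1) * Rpower (1 + t) (- x - 1))))
        with (Rpower t (x - 1) * (C * Rpower (1 + t) (- x - 1))) by (field; lra).
      apply Rmult_le_compat_l; [left; apply exp_pos|].
      replace (exp (- t)) with
        (Rpower (1 + t) (x + 1) * exp (- t) * Rpower (1 + t) (- x - 1)).
      * apply Rmult_le_compat_r; [left; apply exp_pos|].
        apply Rpower_exp_bounded; lra.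
      * rewrite (Rmult_comm (Rpower _ _)), Rmult_assoc, <- Rpower_plus.
        replace (x + 1 + (- x - 1)) with 0 by ring. rewrite Rpower_O by lra. ring.
  - assert (0 < C / x) by now apply Rdiv_lt_0_compat.
    assert (h b <= 1).
    { unfold h. apply Rle_trans with (Rpower (1 + b) x * Rpower (1 + b) (- x)).
      - apply Rmult_le_compat_r; [left; apply exp_pos|].
        apply Rle_Rpower_l; lra.
      - rewrite <- Rpower_plus, Rplus_opp_r, Rpower_O by lra. lra. }
    assert (0 < h a) by (apply Rmult_lt_0_compat; apply exp_pos).
    rewrite <- (Rmult_1_r (C / x)) at 2. apply Rmult_le_compat_l; lra.
Qed.

Lemma Gamma_spec (x : R) : 0 < x ->
  is_RInt_gen (gamma_integrand x) (at_right 0) (Rbar_locally p_infty) (Gamma x) /\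
  (forall a b, 0 < a -> a <= b -> RInt (gamma_integrand x) a b <= Gamma x) /\
  (forall M, (forall a b, 0 < a -> a <= b -> RInt (gamma_integrand x) a b <= M) ->
     Gamma x <= M).
Proof.
  intros Hx.
  destruct (is_RInt_gen_nonneg_bounded (gamma_integrand x)
    (exp ((x + 1) * ln (x + 1) + 1 - (x + 1)) / x)) as (l & Hl & H1 & H2).
  - intros; left; apply gamma_integrand_pos.
  - intros; now apply continuous_gamma_integrand.
  - intros; now apply RInt_gamma_integrand_le.
  - replace (Gamma x) with l; [auto|].
    symmetry. unfold Gamma. exact (is_RInt_gen_unique _ _ Hl).
Qed.

Lemma Gamma_pos (x : R) : 0 < x -> 0 < Gamma x.
Proof.
  intros Hx. destruct (Gamma_spec x Hx) as (_ & H & _).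
  apply Rlt_le_trans with (RInt (gamma_integrand x) 1 2); [|apply H; lra].
  apply RInt_gt_0; [lra|intros; apply gamma_integrand_pos|].
  intros; apply continuous_gamma_integrand; lra.
Qed.

(** Integration by parts: -t^x e^(-t) has derivative t^x e^(-t) - x t^(x-1) e^(-t) and tends to 0 at
    both ends. *)
Lemma Gamma_succ (x : R) : 0 < x -> Gamma (x + 1) = x * Gamma x.
Proof.
  intros Hx.
  set (h := fun t => - (Rpower t x * exp (- t))).
  assert (Hd : forall t, 0 < t ->
    is_derive h t (gamma_integrand (x + 1) t - x * gamma_integrand x t)).
  { intros t Ht. unfold h, gamma_integrand, Rpower. auto_derive; [lra|].
    replace (x + 1 - 1) with x by ring.
    replace (exp ((x - 1) * ln t)) with (exp (x * ln t) * exp (- ln t))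
      by (rewrite <- exp_plus; f_equal; ring).
    rewrite !exp_Ropp, exp_ln by lra. field. split; [|lra].
    apply Rgt_not_eq, exp_pos. }
  assert (H0 : filterlim h (at_right 0) (locally 0)).
  { apply filterlim_locally. intros eps.
    (* The radius is eps^(1/x), below which t^x < eps. *)
    exists (mkposreal _ (exp_pos (ln eps / x))). intros t Ht Ht0.
    apply Rabs_def2 in Ht. unfold minus, plus, opp in Ht. simpl in Ht.
    unfold ball; simpl; unfold AbsRing_ball, abs, minus, plus, opp; simpl.
    assert (0 < exp (- t) < 1).
    { split; [apply exp_pos|]. rewrite <- exp_0. apply exp_increasing. lra. }
    assert (0 < Rpower t x < eps).
    { split; [apply exp_pos|]. unfold Rpower.
      rewrite <- (exp_ln eps) at 1 by apply cond_pos. apply exp_increasing.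
      replace (ln eps) with (x * (ln eps / x)) by (field; lra).
      apply Rmult_lt_compat_l; [lra|]. rewrite <- (ln_exp (ln eps / x)).
      apply ln_increasing; lra. }
    unfold h. apply Rabs_def1; nra. }
  assert (H1 : filterlim h (Rbar_locally p_infty) (locally 0)).
  { apply filterlim_locally. intros eps.
    (* The bound at exponent x + 1 leaves a spare factor 1 + t, so t^x e^(-t) <= C / (1 + t), which
       is below eps once t > C / eps. *)
    set (C := exp ((x + 1) * ln (x + 1) + 1 - (x + 1))).
    assert (HC : 0 < C) by apply exp_pos. assert (He := cond_pos eps).
    exists (C / eps). intros t Ht.
    assert (0 < C / eps) by now apply Rdiv_lt_0_compat.
    unfold ball; simpl; unfold AbsRing_ball, abs, minus, plus, opp; simpl.
    assert (Hb := Rpower_exp_bounded (x + 1) t). fold C in Hb.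
    assert (Hp : Rpower (1 + t) (x + 1) = Rpower (1 + t) x * (1 + t)).
    { rewrite Rpower_plus, Rpower_1 by lra. reflexivity. }
    assert (Rpower t x <= Rpower (1 + t) x) by (apply Rle_Rpower_l; lra).
    assert (0 < Rpower t x) by apply exp_pos. assert (0 < exp (- t)) by apply exp_pos.
    assert (Hq : Rpower t x * exp (- t) * (1 + t) <= C).
    { apply Rle_trans with (Rpower (1 + t) (x + 1) * exp (- t)); [|apply Hb; lra].
      rewrite Hp. assert (Rpower t x * (exp (- t) * (1 + t)) <= Rpower (1 + t) x * (exp (- t) * (1 + t))); [|lra].
      apply Rmult_le_compat_r; [|lra]. apply Rmult_le_pos; lra. }
    assert (Hlt : C < eps * (1 + t)).
    { apply Rmult_lt_compat_l with (r := eps) in Ht; [|lra].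
      replace (eps * (C / eps)) with C in Ht by (field; lra). lra. }
    assert (0 < Rpower t x * exp (- t) < eps).
    { split; [apply Rmult_lt_0_compat; lra|].
      apply Rmult_lt_reg_r with (1 + t); lra. }
    unfold h. apply Rabs_def1; lra. }
  assert (Hpos : forall P : R * R -> Prop,
    (forall a b, 0 < a -> 0 < b -> P (a, b)) ->
    filter_prod (at_right 0) (Rbar_locally p_infty) P).
  { intros P HP. apply (Filter_prod _ _ _ (fun a => 0 < a) (fun b => 0 < b)).
    - exists (mkposreal 1 Rlt_0_1). auto.
    - exists 0. auto.
    - auto. }
  assert (Hmin : forall a b t, 0 < a -> 0 < b -> Rmin a b <= t -> 0 < t).
  { intros a b t Ha Hb Ht. refine (Rlt_le_trans _ _ _ _ Ht). now apply Rmin_glb_lt. }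
  assert (Hh : is_RInt_gen (Derive h) (at_right 0) (Rbar_locally p_infty) (0 - 0)).
  { apply is_RInt_gen_Derive; auto; apply Hpos; simpl.
    - intros a b Ha Hb t [Ht _]. eexists. apply Hd. exact (Hmin a b t Ha Hb Ht).
    - intros a b Ha Hb t [Ht _]. apply Hmin in Ht; auto.
      apply (continuous_ext_loc _
        (fun t => minus (gamma_integrand (x + 1) t) (scal x (gamma_integrand x t)))).
      + exists (mkposreal t Ht). intros y Hy. apply Rabs_def2 in Hy.
        unfold minus, plus, opp in Hy. simpl in Hy. symmetry.
        apply is_derive_unique, Hd. lra.
      + apply (continuous_minus (V := R_NormedModule));
          [|apply (continuous_scal_r (V := R_NormedModule))];
          now apply continuous_gamma_integrand. }
  destruct (Gamma_spec x Hx) as (HG & _ & _).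
  unfold Gamma at 1. refine (is_RInt_gen_unique _ _ _).
  replace (x * Gamma x) with (plus (0 - 0) (scal x (Gamma x)))
    by (unfold plus, scal; simpl; unfold mult; simpl; ring).
  apply (is_RInt_gen_ext (fun t => plus (Derive h t) (scal x (gamma_integrand x t)))).
  - apply Hpos. simpl. intros a b Ha Hb t [Ht _].
    rewrite (is_derive_unique h t _ (Hd t (Hmin a b t Ha Hb (Rlt_le _ _ Ht)))).
    unfold gamma_integrand, plus, scal; simpl; unfold mult; simpl. ring.
  - apply (is_RInt_gen_plus (V := R_NormedModule)); [exact Hh|].
    now apply (is_RInt_gen_scal (V := R_NormedModule)).
Qed.

(** Concavity of the logarithm between u and 1: with v the weighted mean, ln z <= z - 1 is applied
    to u / v and 1 / v, and the right-hand sides cancel when weighted by h and 1 - h. *)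
Lemma Rpower_bernoulli (u h : R) : 0 < u -> 0 <= h <= 1 -> Rpower u h <= 1 - h + h * u.
Proof.
  intros Hu Hh. set (v := 1 - h + h * u).
  assert (Hv : 0 < v) by (unfold v; nra).
  unfold Rpower. rewrite <- (exp_ln v Hv).
  assert (H1 := ln_le_sub_1 (u / v) (Rdiv_lt_0_compat _ _ Hu Hv)).
  assert (H2 := ln_le_sub_1 (1 / v) (Rdiv_lt_0_compat _ _ Rlt_0_1 Hv)).
  rewrite ln_div_pos in H1, H2 by lra. rewrite ln_1 in H2.
  assert (H3 : h * ln u <= ln v).
  { assert (h * (ln u - ln v) <= h * (u / v - 1)) by (apply Rmult_le_compat_l; lra).
    assert ((1 - h) * (0 - ln v) <= (1 - h) * (1 / v - 1)) by (apply Rmult_le_compat_l; lra).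
    assert (h * (u / v - 1) + (1 - h) * (1 / v - 1) = 0).
    { unfold v. field. unfold v in Hv. lra. }
    lra. }
  destruct H3 as [H3|H3]; [left; now apply exp_increasing|right; now rewrite H3].
Qed.

(** Bernoulli gives t^h <= x^h (1 - h + h t / x) under the integral. Integrating leaves x^h ((1 - h)
    Gamma x + (h / x) Gamma (x + 1)), which the functional equation collapses to x^h Gamma x. *)
Lemma Gamma_add_le (x h : R) : 0 < x -> 0 <= h <= 1 ->
  Gamma (x + h) <= Rpower x h * Gamma x.
Proof.
  intros Hx Hh.
  destruct (Gamma_spec x Hx) as (_ & HG & _).
  destruct (Gamma_spec (x + 1)) as (_ & HG1 & _); [lra|].
  destruct (Gamma_spec (x + h)) as (_ & _ & H); [lra|].
  apply H. intros a b Ha Hab.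
  assert (Hp : 0 < Rpower x h) by apply exp_pos.
  assert (Hex : forall z, is_RInt (gamma_integrand z) a b (RInt (gamma_integrand z) a b)).
  { intros z. apply (RInt_correct (V := R_CompleteNormedModule)). apply ex_RInt_pos; try lra.
    intros; now apply continuous_gamma_integrand. }
  apply Rle_trans with (Rpower x h * (1 - h) * RInt (gamma_integrand x) a b
    + Rpower x h * (h / x) * RInt (gamma_integrand (x + 1)) a b).
  - apply (is_RInt_le (gamma_integrand (x + h)) (fun t =>
      Rpower x h * (1 - h) * gamma_integrand x t
      + Rpower x h * (h / x) * gamma_integrand (x + 1) t) a b); auto.
    + apply (is_RInt_plus (V := R_NormedModule));
        apply (is_RInt_scal (V := R_NormedModule)); auto.
    + intros t Ht. unfold gamma_integrand.
      replace (x + h - 1) with (x - 1 + h) by ring.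
      replace (x + 1 - 1) with (x - 1 + 1) by ring.
      rewrite !Rpower_plus, Rpower_1 by lra.
      replace (Rpower t h) with (Rpower x h * Rpower (t / x) h).
      2:{ rewrite Rpower_mult_distr by (try apply Rdiv_lt_0_compat; lra).
          f_equal. field. lra. }
      assert (Hb := Rpower_bernoulli (t / x) h).
      apply Rle_trans with
        (Rpower t (x - 1) * (Rpower x h * (1 - h + h * (t / x))) * exp (- t)).
      * apply Rmult_le_compat_r; [left; apply exp_pos|].
        apply Rmult_le_compat_l; [left; apply exp_pos|].
        apply Rmult_le_compat_l; [left; apply exp_pos|].
        apply Hb; [apply Rdiv_lt_0_compat; lra|exact Hh].
      * right. field. lra.
  - assert (H1 := HG a b Ha Hab). assert (H2 := HG1 a b Ha Hab).
    rewrite Gamma_succ in H2 by assumption.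
    assert (Rpower x h * (1 - h) * RInt (gamma_integrand x) a b
      <= Rpower x h * (1 - h) * Gamma x).
    { apply Rmult_le_compat_l; [apply Rmult_le_pos; lra|exact H1]. }
    assert (Rpower x h * (h / x) * RInt (gamma_integrand (x + 1)) a b
      <= Rpower x h * (h / x) * (x * Gamma x)).
    { apply Rmult_le_compat_l; [apply Rmult_le_pos; [lra|]|exact H2].
      apply Rmult_le_pos; [lra|]. left; now apply Rinv_0_lt_compat. }
    replace (Rpower x h * Gamma x) with
      (Rpower x h * (1 - h) * Gamma x + Rpower x h * (h / x) * (x * Gamma x))
      by (field; lra).
    lra.
Qed.

(** * Digamma and trigamma *)

(** Serves where [f] is known only through estimates: for [psi0], for ln Gamma, and for a primitive
    of t^k ln t at the endpoint 0. *)
Lemma is_derive_quadratic (f : R -> R) (x l C d : R) :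
  0 < d ->
  (forall y, Rabs (y - x) < d -> Rabs (f y - f x - (y - x) * l) <= C * (y - x) ^ 2) ->
  is_derive f x l.
Proof.
  intros Hd H. apply is_derive_Reals. intros eps Heps.
  set (K := Rabs C + 1).
  assert (HK : 0 < K) by (unfold K; generalize (Rabs_pos C); lra).
  assert (Hm : 0 < Rmin d (eps / K)) by (apply Rmin_glb_lt; [|apply Rdiv_lt_0_compat]; lra).
  exists (mkposreal _ Hm). simpl. intros h Hh0 Hh.
  assert (Hh1 := Rlt_le_trans _ _ _ Hh (Rmin_l _ _)).
  assert (Hh2 := Rlt_le_trans _ _ _ Hh (Rmin_r _ _)).
  assert (Ha : 0 < Rabs h) by now apply Rabs_pos_lt.
  specialize (H (x + h)). replace (x + h - x) with h in H by ring.
  specialize (H Hh1).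
  replace ((f (x + h) - f x) / h - l) with ((f (x + h) - f x - h * l) / h) by (now field).
  unfold Rdiv. rewrite Rabs_mult, Rabs_inv.
  apply Rmult_lt_reg_r with (Rabs h); [assumption|].
  rewrite Rmult_assoc, Rinv_l, Rmult_1_r by lra.
  apply Rle_lt_trans with (1 := H). rewrite <- (pow2_abs h).
  apply Rle_lt_trans with (K * Rabs h ^ 2).
  - apply Rmult_le_compat_r; [nra|]. unfold K. generalize (Rle_abs C). lra.
  - assert (K * Rabs h < eps).
    { apply Rmult_lt_compat_l with (r := K) in Hh2; [|assumption].
      replace (K * (eps / K)) with eps in Hh2 by (field; lra). exact Hh2. }
    simpl. nra.
Qed.

Lemma ln_diff_le (a b : R) : 0 < a -> 0 < b -> ln b - ln a <= (b - a) / a.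
Proof.
  intros Ha Hb. rewrite <- ln_div_pos by assumption.
  replace ((b - a) / a) with (b / a - 1) by (field; lra).
  apply ln_le_sub_1, Rdiv_lt_0_compat; assumption.
Qed.

Lemma is_lim_seq_inv_shift (c x : R) : is_lim_seq (fun N => c / (x + INR N)) 0.
Proof.
  replace (Finite 0) with (Rbar_mult c (Rbar_inv p_infty)) by (simpl; f_equal; ring).
  apply (is_lim_seq_scal_l (fun N => / (x + INR N))).
  apply is_lim_seq_inv; [|discriminate].
  replace p_infty with (Rbar_plus x p_infty) by reflexivity.
  apply (is_lim_seq_plus _ _ x p_infty); [apply is_lim_seq_const|apply is_lim_seq_INR|].
  reflexivity.
Qed.

Lemma is_lim_seq_abs_le (u v : nat -> R) (l : R) :
  (forall n, Rabs (u n - l) <= v n) -> is_lim_seq v 0 -> is_lim_seq u l.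
Proof.
  intros H Hv. apply (is_lim_seq_le_le (fun n => l - v n) u (fun n => l + v n)).
  - intros n. specialize (H n). apply Rabs_le_between in H. lra.
  - replace (Finite l) with (Finite (l - 0)) by (f_equal; ring).
    apply is_lim_seq_minus'; [apply is_lim_seq_const|assumption].
  - replace (Finite l) with (Finite (l + 0)) by (f_equal; ring).
    apply is_lim_seq_plus'; [apply is_lim_seq_const|assumption].
Qed.

Lemma ln_Gamma_shift (x : R) (N : nat) : 0 < x ->
  ln (Gamma (x + INR N)) = ln (Gamma x) + Rsum N (fun k => ln (x + INR k)).
Proof.
  intros Hx. induction N as [|N IH].
  - rewrite Rsum_0. simpl. rewrite !Rplus_0_r. reflexivity.
  - assert (HN := pos_INR N).
    rewrite Rsum_S, S_INR, <- Rplus_assoc, Gamma_succ, ln_mult, IH by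
      (try apply Gamma_pos; lra). ring.
Qed.

(** The upper bound is [Gamma_add_le] at z; the lower one is the same inequality for the step 1 - h
    from z + h to z + 1, combined with Gamma (z + 1) = z Gamma z. *)
Lemma ln_Gamma_add (z h : R) : 0 < z -> 0 <= h <= 1 ->
  Rabs (ln (Gamma (z + h)) - ln (Gamma z) - h * ln z) <= 1 / z.
Proof.
  intros Hz Hh.
  assert (Hln : forall w k, 0 < w -> 0 <= k <= 1 ->
    ln (Gamma (w + k)) <= k * ln w + ln (Gamma w)).
  { intros w k Hw Hk. unfold Rpower.
    rewrite <- (ln_exp (k * ln w)), <- ln_mult by (try apply exp_pos; now apply Gamma_pos).
    apply ln_le; [apply Gamma_pos; lra|]. now apply Gamma_add_le. }
  assert (H1 := Hln z h Hz Hh).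
  assert (H2 : ln (Gamma (z + 1)) <= (1 - h) * ln (z + h) + ln (Gamma (z + h))).
  { replace (z + 1) with (z + h + (1 - h)) by ring. apply Hln; lra. }
  rewrite Gamma_succ, ln_mult in H2 by (try apply Gamma_pos; assumption).
  assert (H3 := ln_diff_le z (z + h) Hz). replace (z + h - z) with h in H3 by ring.
  assert (H4 : (1 - h) * (ln (z + h) - ln z) <= (1 - h) * (h / z))
    by (apply Rmult_le_compat_l; lra).
  assert (Hi : 0 < / z) by now apply Rinv_0_lt_compat.
  apply Rabs_le. unfold Rdiv in *. nra.
Qed.

Lemma ln_Gamma_asymp (x y : R) : 0 < x -> 0 < y -> Rabs (y - x) <= 1 ->
  is_lim_seq (fun N =>
    ln (Gamma (y + INR N)) - ln (Gamma (x + INR N)) - (y - x) * ln (x + INR N)) 0.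
Proof.
  intros Hx Hy Hxy. apply Rabs_le_between in Hxy.
  set (m := Rmin x y).
  assert (Hm : 0 < m) by now apply Rmin_glb_lt.
  assert (Hmx : m <= x) by apply Rmin_l. assert (Hmy : m <= y) by apply Rmin_r.
  apply is_lim_seq_abs_le with (fun N => 2 / (m + INR N)); [|apply is_lim_seq_inv_shift].
  intros N. rewrite Rminus_0_r. assert (HN := pos_INR N).
  assert (Hinv : forall w, m <= w -> / (w + INR N) <= / (m + INR N))
    by (intros; apply Rinv_le_contravar; lra).
  assert (H0 : 0 < / (m + INR N)) by (apply Rinv_0_lt_compat; lra).
  destruct (Rle_dec x y) as [Hle|Hgt].
  - assert (H := ln_Gamma_add (x + INR N) (y - x)).
    replace (x + INR N + (y - x)) with (y + INR N) in H by ring.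
    eapply Rle_trans; [apply H; lra|]. specialize (Hinv x Hmx). unfold Rdiv. lra.
  - assert (H := ln_Gamma_add (y + INR N) (x - y)).
    replace (y + INR N + (x - y)) with (x + INR N) in H by ring.
    assert (H' : Rabs (ln (Gamma (x + INR N)) - ln (Gamma (y + INR N)) - (x - y) * ln (y + INR N))
      <= 1 / (y + INR N)) by (apply H; lra).
    apply Rabs_le_between in H'.
    assert (H1 := ln_diff_le (y + INR N) (x + INR N)).
    assert (H2 : 0 <= ln (x + INR N) - ln (y + INR N)).
    { assert (ln (y + INR N) <= ln (x + INR N)); [apply ln_le; lra|lra]. }
    (* Here the estimate is based at y + N, and moving its logarithm to x + N costs one further 1 /
       (y + N); hence the 2 in the majorant. *)
    assert (H3 : (x - y) * (ln (x + INR N) - ln (y + INR N)) <= 1 / (y + INR N)).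
    { apply Rle_trans with (1 * (ln (x + INR N) - ln (y + INR N))).
      - apply Rmult_le_compat_r; lra.
      - eapply Rle_trans; [rewrite Rmult_1_l; apply H1; lra|].
        apply Rmult_le_compat_r; [left; apply Rinv_0_lt_compat|]; lra. }
    assert (H4 : 0 <= (x - y) * (ln (x + INR N) - ln (y + INR N)))
      by (apply Rmult_le_pos; lra).
    specialize (Hinv y Hmy). unfold Rdiv in *. apply Rabs_le. lra.
Qed.

(** Euler's limit for the digamma function, with ln (x + N) in place of ln N: the limit is unchanged
    and the sequence becomes decreasing. *)
Definition digamma_seq (x : R) (N : nat) : R :=
  ln (x + INR N) - Rsum N (fun k => / (x + INR k)).

Lemma ex_lim_digamma_seq (x : R) : 0 < x -> ex_finite_lim_seq (digamma_seq x).
Proof.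
  intros Hx. apply ex_finite_lim_seq_decr with (ln x - / x).
  - intros N. unfold digamma_seq. rewrite Rsum_S, S_INR. assert (HN := pos_INR N).
    assert (H := ln_diff_le (x + INR N) (x + (INR N + 1))).
    replace (x + (INR N + 1) - (x + INR N)) with 1 in H by ring.
    unfold Rdiv in H. lra.
  - intros N. unfold digamma_seq. destruct N as [|N].
    + rewrite Rsum_0. simpl. rewrite Rplus_0_r.
      assert (0 < / x) by now apply Rinv_0_lt_compat. lra.
    (* Comparison with the logarithm, 1 / (x + k + 1) <= ln (x + k + 1) - ln (x + k), bounds the
       decreasing sequence from below. *)
    + assert (H : Rsum (S N) (fun k => / (x + INR k)) <= / x + ln (x + INR N) - ln x).
      { induction N as [|N IH].
        - rewrite Rsum_S, Rsum_0. simpl. rewrite Rplus_0_r. lra.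
        - rewrite Rsum_S. assert (HN := pos_INR N). rewrite S_INR.
          assert (H := ln_diff_le (x + (INR N + 1)) (x + INR N)).
          replace ((x + INR N - (x + (INR N + 1))) / (x + (INR N + 1)))
            with (- / (x + (INR N + 1))) in H by (field; lra). lra. }
      assert (HN := pos_INR N). rewrite S_INR.
      assert (ln (x + INR N) <= ln (x + (INR N + 1))) by (apply ln_le; lra). lra.
Qed.

Definition psi0 (x : R) : R := real (Lim_seq (digamma_seq x)).

Lemma is_lim_digamma_seq (x : R) : 0 < x -> is_lim_seq (digamma_seq x) (psi0 x).
Proof. intros Hx. apply Lim_seq_correct', ex_lim_digamma_seq, Hx. Qed.

Lemma Rsum_inv_sq_le (x : R) (N : nat) : 0 < x ->
  Rsum N (fun k => / (x + INR k) ^ 2) <= / x ^ 2 + / x.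
Proof.
  intros Hx.
  assert (Hx2 : 0 < / x ^ 2) by (apply Rinv_0_lt_compat, pow_lt, Hx).
  assert (Hx1 : 0 < / x) by (apply Rinv_0_lt_compat, Hx).
  destruct N as [|N]; [rewrite Rsum_0; lra|].
  (* The telescoping remainder - 1 / (x + N) is kept in the bound so that the induction closes. *)
  assert (H : Rsum (S N) (fun k => / (x + INR k) ^ 2) <= / x ^ 2 + / x - / (x + INR N)).
  { induction N as [|N IH].
    - rewrite Rsum_S, Rsum_0. simpl INR. rewrite Rplus_0_r. lra.
    - rewrite Rsum_S. assert (HN := pos_INR N). rewrite S_INR.
      assert (Hk : / (x + INR N) - / (x + (INR N + 1)) - / (x + (INR N + 1)) ^ 2
        = / ((x + INR N) * (x + (INR N + 1)) ^ 2)) by (field; lra).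
      assert (0 < / ((x + INR N) * (x + (INR N + 1)) ^ 2)).
      { apply Rinv_0_lt_compat, Rmult_lt_0_compat; [|apply pow_lt]; lra. }
      lra. }
  assert (HN := pos_INR N).
  assert (0 < / (x + INR N)) by (apply Rinv_0_lt_compat; lra). lra.
Qed.

Lemma ex_lim_Rsum_inv_sq (x : R) : 0 < x ->
  ex_finite_lim_seq (fun N => Rsum N (fun k => / (x + INR k) ^ 2)).
Proof.
  intros Hx. apply ex_finite_lim_seq_incr with (/ x ^ 2 + / x).
  - intros N. rewrite Rsum_S. assert (HN := pos_INR N).
    assert (0 < / (x + INR N) ^ 2) by (apply Rinv_0_lt_compat, pow_lt; lra). lra.
  - intros N. now apply Rsum_inv_sq_le.
Qed.

Lemma is_lim_seq_ln_diff (x y : R) : 0 < x -> 0 < y ->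
  is_lim_seq (fun N => ln (y + INR N) - ln (x + INR N)) 0.
Proof.
  intros Hx Hy.
  apply is_lim_seq_abs_le with (fun N => Rabs (y - x) / (x + INR N) + Rabs (y - x) / (y + INR N)).
  - intros N. rewrite Rminus_0_r. assert (HN := pos_INR N).
    assert (H1 := ln_diff_le (x + INR N) (y + INR N)).
    assert (H2 := ln_diff_le (y + INR N) (x + INR N)).
    replace (y + INR N - (x + INR N)) with (y - x) in H1 by ring.
    replace (x + INR N - (y + INR N)) with (- (y - x)) in H2 by ring.
    assert (Ha := Rle_abs (y - x)). assert (Hb := Rle_abs (- (y - x))).
    rewrite Rabs_Ropp in Hb. assert (Hc := Rabs_pos (y - x)).
    assert (Hix : 0 < / (x + INR N)) by (apply Rinv_0_lt_compat; lra).
    assert (Hiy : 0 < / (y + INR N)) by (apply Rinv_0_lt_compat; lra).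
    unfold Rdiv in *.
    assert ((y - x) * / (x + INR N) <= Rabs (y - x) * / (x + INR N))
      by (apply Rmult_le_compat_r; lra).
    assert (- (y - x) * / (y + INR N) <= Rabs (y - x) * / (y + INR N))
      by (apply Rmult_le_compat_r; lra).
    assert (0 <= Rabs (y - x) * / (x + INR N)) by (apply Rmult_le_pos; lra).
    assert (0 <= Rabs (y - x) * / (y + INR N)) by (apply Rmult_le_pos; lra).
    apply Rabs_le. lra.
  - replace (Finite 0) with (Finite (0 + 0)) by (f_equal; ring).
    apply is_lim_seq_plus'; apply is_lim_seq_inv_shift.
Qed.

(** With a = x + k and b = y + k, 1/a - 1/b - (b - a)/a^2 = - (b - a)^2 / (a^2 b). The estimate thus
    holds for every partial sum, where y >= x / 2 gives 1/b <= 2/x, and survives the limit. *)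
Lemma psi0_quadratic (x y T : R) : 0 < x -> x / 2 <= y ->
  is_lim_seq (fun N => Rsum N (fun k => / (x + INR k) ^ 2)) T ->
  Rabs (psi0 y - psi0 x - (y - x) * T) <= 2 / x * (/ x ^ 2 + / x) * (y - x) ^ 2.
Proof.
  intros Hx Hy HT.
  set (C := 2 / x * (/ x ^ 2 + / x)).
  assert (Hix : 0 < / x) by now apply Rinv_0_lt_compat.
  assert (Hlim : is_lim_seq (fun N => Rabs (digamma_seq y N - digamma_seq x N
      - (y - x) * Rsum N (fun k => / (x + INR k) ^ 2) - (ln (y + INR N) - ln (x + INR N))))
    (Rabs (psi0 y - psi0 x - (y - x) * T - 0))).
  { apply (is_lim_seq_abs _ (Finite (psi0 y - psi0 x - (y - x) * T - 0))).
    apply is_lim_seq_minus'; [apply is_lim_seq_minus'; [apply is_lim_seq_minus'|]|].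
    - apply is_lim_digamma_seq; lra.
    - now apply is_lim_digamma_seq.
    - apply (is_lim_seq_scal_l _ (y - x) T HT).
    - apply is_lim_seq_ln_diff; lra. }
  rewrite Rminus_0_r in Hlim.
  assert (Hle : Rbar_le (Rabs (psi0 y - psi0 x - (y - x) * T)) (C * (y - x) ^ 2)); [|exact Hle].
  refine (is_lim_seq_le _ _ _ _ _ Hlim (is_lim_seq_const _)).
  intros N.
  replace (digamma_seq y N - digamma_seq x N
      - (y - x) * Rsum N (fun k => / (x + INR k) ^ 2) - (ln (y + INR N) - ln (x + INR N)))
    with (- (y - x) ^ 2 * Rsum N (fun k => / ((x + INR k) ^ 2 * (y + INR k)))).
  2:{ unfold digamma_seq. rewrite <- !Rsum_scal.
      transitivity ((-1) * Rsum N (fun k => / (y + INR k)) + Rsum N (fun k => / (x + INR k))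
        + (-1) * Rsum N (fun k => (y - x) * / (x + INR k) ^ 2)); [|ring].
      rewrite <- !Rsum_scal, <- !Rsum_plus. apply Rsum_ext. intros k _.
      assert (Hk := pos_INR k). field. lra. }
  rewrite Rabs_mult, Rabs_Ropp, (Rabs_pos_eq _ (pow2_ge_0 _)), Rmult_comm.
  apply Rmult_le_compat_r; [apply pow2_ge_0|].
  assert (Hp : forall k, 0 < / (x + INR k) ^ 2).
  { intros k. assert (Hk := pos_INR k). apply Rinv_0_lt_compat, pow_lt. lra. }
  rewrite Rabs_pos_eq.
  - apply Rle_trans with (2 / x * Rsum N (fun k => / (x + INR k) ^ 2)).
    + rewrite <- Rsum_scal. apply Rsum_le. intros k _. assert (Hk := pos_INR k).
      rewrite Rinv_mult, Rmult_comm. apply Rmult_le_compat_r; [left; apply Hp|].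
      replace (2 / x) with (/ (x / 2)) by (field; lra).
      apply Rinv_le_contravar; lra.
    + apply Rmult_le_compat_l; [unfold Rdiv; lra|]. now apply Rsum_inv_sq_le.
  - apply Rsum_nonneg. intros k _. assert (Hk := pos_INR k).
    left. apply Rinv_0_lt_compat, Rmult_lt_0_compat; [apply pow_lt|]; lra.
Qed.

(** Convexity of ln Gamma with slope [psi0 x]. Once both values are shifted by N, the difference is
    a sum of terms (y - x)/(x + k) - (ln (y + k) - ln (x + k)), each nonnegative by [ln_diff_le], up
    to an error tending to 0. *)
Lemma ln_Gamma_above_tangent (x y : R) : 0 < x -> 0 < y -> Rabs (y - x) <= 1 ->
  0 <= ln (Gamma y) - ln (Gamma x) - (y - x) * psi0 x.
Proof.
  intros Hx Hy Hxy.
  assert (Hlim : is_lim_seq (fun N => ln (Gamma y) - ln (Gamma x) - (y - x) * digamma_seq x N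
      - (ln (Gamma (y + INR N)) - ln (Gamma (x + INR N)) - (y - x) * ln (x + INR N)))
    (ln (Gamma y) - ln (Gamma x) - (y - x) * psi0 x - 0)).
  { apply is_lim_seq_minus'; [apply is_lim_seq_minus'|].
    - apply is_lim_seq_const.
    - apply (is_lim_seq_scal_l _ (y - x) (psi0 x)). now apply is_lim_digamma_seq.
    - now apply ln_Gamma_asymp. }
  rewrite Rminus_0_r in Hlim.
  assert (Hle : Rbar_le 0 (ln (Gamma y) - ln (Gamma x) - (y - x) * psi0 x)); [|exact Hle].
  refine (is_lim_seq_le _ _ _ _ _ (is_lim_seq_const _) Hlim).
  intros N. rewrite !ln_Gamma_shift by assumption. unfold digamma_seq.
  match goal with |- 0 <= ?A => replace A with ((y - x) * Rsum N (fun k => / (x + INR k))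
    + (-1) * Rsum N (fun k => ln (y + INR k)) + Rsum N (fun k => ln (x + INR k))) by ring end.
  rewrite <- !Rsum_scal, <- !Rsum_plus. apply Rsum_nonneg. intros k _.
  assert (Hk := pos_INR k). assert (H := ln_diff_le (x + INR k) (y + INR k)).
  replace (y + INR k - (x + INR k)) with (y - x) in H by ring. unfold Rdiv in H. lra.
Qed.

Lemma is_derive_psi0 (x T : R) : 0 < x ->
  is_lim_seq (fun N => Rsum N (fun k => / (x + INR k) ^ 2)) T -> is_derive psi0 x T.
Proof.
  intros Hx HT. apply is_derive_quadratic with (2 / x * (/ x ^ 2 + / x)) (x / 2); [lra|].
  intros y Hy. apply Rabs_def2 in Hy. apply psi0_quadratic; auto; lra.
Qed.

(** The tangent inequalities at x and at y trap the error ln Gamma y - ln Gamma x - (y - x) psi0 x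
    between 0 and (y - x)(psi0 y - psi0 x), which is quadratic in y - x by [psi0_quadratic]. *)
Lemma is_derive_ln_Gamma (x : R) : 0 < x -> is_derive (fun y => ln (Gamma y)) x (psi0 x).
Proof.
  intros Hx. destruct (ex_lim_Rsum_inv_sq x Hx) as [T HT].
  set (C := 2 / x * (/ x ^ 2 + / x)).
  assert (HC : 0 < C).
  { assert (0 < / x) by now apply Rinv_0_lt_compat.
    assert (0 < / x ^ 2) by now apply Rinv_0_lt_compat, pow_lt.
    unfold C, Rdiv. nra. }
  apply is_derive_quadratic with (Rabs T + C) (Rmin 1 (x / 2)); [apply Rmin_glb_lt; lra|].
  intros y Hy.
  assert (Hy1 := Rlt_le_trans _ _ _ Hy (Rmin_l _ _)).
  assert (Hy2 := Rlt_le_trans _ _ _ Hy (Rmin_r _ _)).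
  assert (Hy3 := Rabs_def2 _ _ Hy2).
  assert (H1 := ln_Gamma_above_tangent x y). assert (H2 := ln_Gamma_above_tangent y x).
  assert (H3 := psi0_quadratic x y T Hx). fold C in H3.
  assert (H1' : 0 <= ln (Gamma y) - ln (Gamma x) - (y - x) * psi0 x) by (apply H1; lra).
  assert (H2' : 0 <= ln (Gamma x) - ln (Gamma y) - (x - y) * psi0 y)
    by (apply H2; try rewrite Rabs_minus_sym; lra).
  rewrite Rabs_pos_eq by assumption.
  apply Rle_trans with ((y - x) * (psi0 y - psi0 x)); [lra|].
  apply Rle_trans with (Rabs (y - x) * Rabs (psi0 y - psi0 x)).
  { rewrite <- Rabs_mult. apply Rle_abs. }
  rewrite <- (pow2_abs (y - x)) in H3 |- *.
  assert (H4 : Rabs (psi0 y - psi0 x) <= Rabs (y - x) * Rabs T + C * Rabs (y - x) ^ 2).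
  { replace (psi0 y - psi0 x) with ((y - x) * T + (psi0 y - psi0 x - (y - x) * T)) by ring.
    eapply Rle_trans; [apply Rabs_triang|]. rewrite Rabs_mult.
    apply Rplus_le_compat_l. apply H3; [lra|assumption]. }
  assert (Hp := Rabs_pos (y - x)).
  apply Rle_trans with (Rabs (y - x) * (Rabs (y - x) * Rabs T + C * Rabs (y - x) ^ 2)).
  { now apply Rmult_le_compat_l. }
  replace (Rabs (y - x) * (Rabs (y - x) * Rabs T + C * Rabs (y - x) ^ 2)) with
    ((Rabs T + C * Rabs (y - x)) * Rabs (y - x) ^ 2) by ring.
  apply Rmult_le_compat_r; [apply pow2_ge_0|]. nra.
Qed.

Lemma digamma_psi0 (x : R) : 0 < x -> digamma x = psi0 x.
Proof.
  intros Hx. unfold digamma.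
  assert (HG := Gamma_pos x Hx).
  assert (Hd : is_derive Gamma x (psi0 x * Gamma x)).
  { apply (is_derive_ext_loc (fun y => exp (ln (Gamma y)))).
    - exists (mkposreal x Hx). intros y Hy. apply Rabs_def2 in Hy.
      unfold minus, plus, opp in Hy; simpl in Hy.
      apply exp_ln, Gamma_pos. lra.
    - rewrite <- (exp_ln (Gamma x)) by assumption.
      apply (is_derive_comp exp (fun y => ln (Gamma y))).
      + apply is_derive_exp.
      + now apply is_derive_ln_Gamma. }
  rewrite (is_derive_unique _ _ _ Hd). field. lra.
Qed.

Lemma is_lim_seq_trigamma (x : R) : 0 < x ->
  is_lim_seq (fun N => Rsum N (fun k => / (x + INR k) ^ 2)) (trigamma x).
Proof.
  intros Hx. destruct (ex_lim_Rsum_inv_sq x Hx) as [T HT].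
  replace (trigamma x) with T; [exact HT|]. symmetry. unfold trigamma.
  apply is_derive_unique. apply (is_derive_ext_loc psi0); [|now apply is_derive_psi0].
  exists (mkposreal x Hx). intros y Hy. apply Rabs_def2 in Hy.
  unfold minus, plus, opp in Hy; simpl in Hy. symmetry. apply digamma_psi0. lra.
Qed.

(** * The geometric series *)

Lemma Rabs_mul_ln_le_1 (x : R) : 0 < x <= 1 -> Rabs (x * ln x) <= 1.
Proof.
  intros Hx.
  assert (H1 : ln x <= 0) by (rewrite <- ln_1; apply ln_le; lra).
  assert (H2 := ln_diff_le x 1). rewrite ln_1 in H2.
  assert (H3 : x * (0 - ln x) <= x * ((1 - x) / x)) by (apply Rmult_le_compat_l; lra).
  replace (x * ((1 - x) / x)) with (1 - x) in H3 by (field; lra).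
  apply Rabs_le. nra.
Qed.

(* [ln] is [0] on the nonpositive reals, so the bound holds on both sides of [0]. *)
Lemma Rabs_pow_mul_ln_le (n : nat) (x : R) : Rabs x <= 1 ->
  Rabs (x ^ S n * ln x) <= Rabs x ^ n.
Proof.
  intros Hx. destruct (Rlt_le_dec 0 x) as [H0|H0].
  - rewrite (Rabs_pos_eq x) in Hx |- * by lra.
    replace (x ^ S n * ln x) with (x ^ n * (x * ln x)) by (simpl; ring).
    rewrite Rabs_mult, (Rabs_pos_eq (x ^ n)) by (apply pow_le; lra).
    rewrite <- (Rmult_1_r (x ^ n)) at 2.
    apply Rmult_le_compat_l; [apply pow_le; lra|]. apply Rabs_mul_ln_le_1; lra.
  - replace (ln x) with 0.
    + rewrite Rmult_0_r, Rabs_R0. apply pow_le, Rabs_pos.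
    + unfold ln. destruct (Rlt_dec 0 x); [exfalso; lra|reflexivity].
Qed.

Lemma continuous_pow_mul_ln (n : nat) (x : R) : 0 <= x ->
  continuous (fun t => t ^ (n + 2) * ln t) x.
Proof.
  intros [Hx|<-].
  - apply ex_derive_continuous_R.
    auto_derive. lra.
  - apply continuity_pt_filterlim. intros eps Heps.
    exists (Rmin 1 eps). split; [apply Rmin_glb_lt; lra|].
    intros t [_ Ht]. simpl in Ht. unfold Rdist in *. rewrite Rminus_0_r in Ht.
    assert (H1 := Rlt_le_trans _ _ _ Ht (Rmin_l _ _)).
    assert (H2 := Rlt_le_trans _ _ _ Ht (Rmin_r _ _)).
    unfold dist; simpl; unfold Rdist.
    rewrite (pow_i (n + 2)), Rmult_0_l, Rminus_0_r by lia.
    apply Rle_lt_trans with (2 := H2).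
    replace (n + 2)%nat with (S (S n)) by lia.
    apply Rle_trans with (1 := Rabs_pow_mul_ln_le (S n) t (Rlt_le _ _ H1)).
    assert (H3 := Rabs_pos t).
    assert (H4 : Rabs t ^ n <= 1) by (rewrite <- (pow1 n); apply pow_incr; lra).
    change (Rabs t ^ S n) with (Rabs t * Rabs t ^ n). nra.
Qed.

Lemma is_RInt_pow_mul_ln (n : nat) :
  is_RInt (fun t => t ^ (n + 2) * ln t) 0 1 (- / (INR n + 3) ^ 2).
Proof.
  assert (Hn := pos_INR n).
  set (W := fun t => t ^ (n + 3) * ln t / (INR n + 3) - t ^ (n + 3) / (INR n + 3) ^ 2).
  assert (HnS : INR (n + 3) = INR n + 3) by (rewrite plus_INR; simpl; ring).
  replace (- / (INR n + 3) ^ 2) with (minus (W 1) (W 0)).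
  2:{ unfold W, minus, plus, opp; simpl. rewrite pow1, (pow_i (n + 3)), ln_1 by lia.
      field. lra. }
  apply (is_RInt_derive (V := R_CompleteNormedModule));
    intros t Ht; rewrite Rmin_left, Rmax_right in Ht by lra.
  2: apply continuous_pow_mul_ln; lra.
  destruct (proj1 Ht) as [Ht0|<-].
  - unfold W. auto_derive; [assumption|]. rewrite HnS.
    replace (Init.Nat.pred (n + 3)) with (n + 2)%nat by lia.
    replace (n + 3)%nat with (S (n + 2)) by lia. simpl pow. field. lra.
  - replace (0 ^ (n + 2) * ln 0) with 0 by (rewrite pow_i by lia; ring).
    (* The fundamental theorem asks for a two-sided derivative of the primitive at 0. It exists
       because |W y| is at most a constant times y^2 for |y| < 1, negative y included, where [ln] is
       0. *)
    apply is_derive_quadratic with (/ (INR n + 3) + / (INR n + 3) ^ 2) 1; [lra|].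
    intros y Hy. rewrite Rminus_0_r in Hy |- *. unfold W.
    rewrite (pow_i (n + 3)) by lia.
    replace (y ^ (n + 3) * ln y / (INR n + 3) - y ^ (n + 3) / (INR n + 3) ^ 2 -
      (0 * ln 0 / (INR n + 3) - 0 / (INR n + 3) ^ 2) - y * 0) with
      (/ (INR n + 3) * (y ^ (n + 3) * ln y) + - (/ (INR n + 3) ^ 2 * y ^ (n + 3)))
      by (field; lra).
    eapply Rle_trans; [apply Rabs_triang|].
    assert (Hi1 : 0 < / (INR n + 3)) by (apply Rinv_0_lt_compat; lra).
    assert (Hi2 : 0 < / (INR n + 3) ^ 2) by (apply Rinv_0_lt_compat, pow_lt; lra).
    rewrite Rabs_Ropp, !Rabs_mult, (Rabs_pos_eq (/ (INR n + 3))),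
      (Rabs_pos_eq (/ (INR n + 3) ^ 2)), <- (Rabs_mult (y ^ (n + 3))), Rmult_plus_distr_r by lra.
    assert (Ha := Rabs_pos y).
    assert (Hp : forall k, Rabs y ^ k <= 1) by (intros k; rewrite <- (pow1 k); apply pow_incr; lra).
    assert (Hp2 : forall k, Rabs y ^ (k + 2) <= y ^ 2).
    { intros k. rewrite pow_add, <- (pow2_abs y).
      assert (H1 := pow2_ge_0 (Rabs y)). specialize (Hp k). nra. }
    apply Rplus_le_compat; apply Rmult_le_compat_l; try lra.
    + replace (n + 3)%nat with (S (n + 2)) by lia.
      eapply Rle_trans; [apply Rabs_pow_mul_ln_le; lra|]. apply Hp2.
    + rewrite <- RPow_abs. replace (n + 3)%nat with (S n + 2)%nat by lia. apply Hp2.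
Qed.

Lemma continuous_sq_mul_ln_div (t : R) : 0 <= t ->
  continuous (fun t => t ^ 2 * ln t / (1 + t ^ 4)) t.
Proof.
  intros Ht. apply (continuous_mult (K := R_AbsRing)).
  - exact (continuous_pow_mul_ln 0 t Ht).
  - apply ex_derive_continuous_R.
    auto_derive. assert (0 <= t ^ 4) by (apply pow_le; assumption). simpl in *. lra.
Qed.

(* Expand [1 / (1 + x^4)] into the geometric series
   [sum_k (x^(8k) - x^(8k+4))] and integrate term by term. *)
Lemma RInt_sq_mul_ln_div :
  RInt (fun t => t ^ 2 * ln t / (1 + t ^ 4)) 0 1 =
  (trigamma (7 / 8) - trigamma (3 / 8)) / 64.
Proof.
  set (B := RInt _ 0 1).
  set (c := fun k => - / (8 * INR k + 3) ^ 2 + / (8 * INR k + 7) ^ 2).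
  assert (H4 : forall t, 0 < 1 + t ^ 4).
  { intros t. replace (t ^ 4) with ((t ^ 2) ^ 2) by ring.
    generalize (pow2_ge_0 (t ^ 2)). lra. }
  (* The remainder after N terms is itself an integral, because t^8 / (1 + t^4) = 1 / (1 + t^4) - 1
     + t^4. It lies between - 1 / (8 N + 3)^2 and 0. *)
  assert (HI : forall N, is_RInt (fun t => t ^ (8 * N + 2) * ln t / (1 + t ^ 4)) 0 1
     (B - Rsum N c)).
  { induction N as [|N IH].
    - rewrite Rsum_0, Rminus_0_r. apply (RInt_correct (V := R_CompleteNormedModule)).
      apply (ex_RInt_continuous (V := R_CompleteNormedModule)). intros t Ht.
      rewrite Rmin_left in Ht by lra. now apply continuous_sq_mul_ln_div.
    - rewrite Rsum_S. unfold c at 2.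
      replace (B - (Rsum N c + (- / (8 * INR N + 3) ^ 2 + / (8 * INR N + 7) ^ 2))) with
        (plus (minus (B - Rsum N c) (- / (INR (8 * N) + 3) ^ 2)) (- / (INR (8 * N + 4) + 3) ^ 2)).
      2:{ rewrite plus_INR, mult_INR. replace (INR 8) with 8 by (simpl; ring).
          replace (INR 4) with 4 by (simpl; ring).
          replace (8 * INR N + 4 + 3) with (8 * INR N + 7) by ring.
          unfold minus, plus, opp; simpl. ring. }
      apply (is_RInt_ext (fun t => plus (minus (t ^ (8 * N + 2) * ln t / (1 + t ^ 4))
        (t ^ (8 * N + 2) * ln t)) (t ^ (8 * N + 4 + 2) * ln t))).
      + intros t _. unfold minus, plus, opp; simpl plus.
        replace (8 * S N + 2)%nat with (8 * N + 2 + 8)%nat by lia.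
        replace (8 * N + 4 + 2)%nat with (8 * N + 2 + 4)%nat by lia.
        rewrite (pow_add t (8 * N + 2) 8), (pow_add t (8 * N + 2) 4).
        simpl. field. specialize (H4 t). simpl in H4. lra.
      + apply (is_RInt_plus (V := R_NormedModule));
          [apply (is_RInt_minus (V := R_NormedModule))|]; auto using is_RInt_pow_mul_ln. }
  assert (Hlim : is_lim_seq (fun N => Rsum N c) B).
  { apply is_lim_seq_abs_le with (fun N => 1 / (3 + INR N)); [|apply is_lim_seq_inv_shift].
    intros N. assert (HN := pos_INR N).
    assert (Hln : forall t, 0 < t < 1 -> ln t <= 0) by (intros; rewrite <- ln_1; apply ln_le; lra).
    assert (Hp : forall t, 0 < t < 1 -> t ^ (8 * N + 2) * ln t <= 0).
    { intros t Ht. specialize (Hln t Ht). assert (0 < t ^ (8 * N + 2)) by (apply pow_lt; lra). nra. }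
    assert (H1 : B - Rsum N c <= 0).
    { apply (is_RInt_le _ (fun _ => 0) 0 1 _ _ Rle_0_1 (HI N)).
      - replace 0 with (scal (1 - 0) 0) at 2 by (unfold scal; simpl; unfold mult; simpl; ring).
        apply (is_RInt_const (V := R_NormedModule)).
      - intros t Ht. specialize (Hp t Ht). specialize (H4 t).
        assert (0 < / (1 + t ^ 4)) by now apply Rinv_0_lt_compat.
        unfold Rdiv. nra. }
    assert (H2 : - / (INR (8 * N) + 3) ^ 2 <= B - Rsum N c).
    { apply (is_RInt_le _ _ 0 1 _ _ Rle_0_1 (is_RInt_pow_mul_ln (8 * N)) (HI N)).
      intros t Ht. specialize (Hp t Ht). specialize (H4 t).
      assert (0 <= t ^ 4) by (apply pow_le; lra).
      assert (/ (1 + t ^ 4) <= 1).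
      { rewrite <- Rinv_1. apply Rinv_le_contravar; lra. }
      unfold Rdiv. nra. }
    assert (H3 : / (INR (8 * N) + 3) ^ 2 <= 1 / (3 + INR N)).
    { unfold Rdiv. rewrite Rmult_1_l, mult_INR. replace (INR 8) with 8 by (simpl; ring).
      apply Rinv_le_contravar; nra. }
    apply Rabs_le. lra. }
  assert (Hlim2 : is_lim_seq (fun N => Rsum N c) ((trigamma (7 / 8) - trigamma (3 / 8)) / 64)).
  { apply (is_lim_seq_ext (fun N => / 64 * (Rsum N (fun k => / (7 / 8 + INR k) ^ 2)
      - Rsum N (fun k => / (3 / 8 + INR k) ^ 2)))).
    - intros N. unfold c. induction N as [|N IH]; rewrite ?Rsum_0, ?Rsum_S; [ring|].
      rewrite <- IH. assert (HN := pos_INR N). field. repeat split; lra.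
    - replace (Finite ((trigamma (7 / 8) - trigamma (3 / 8)) / 64)) with
        (Rbar_mult (/ 64) (trigamma (7 / 8) - trigamma (3 / 8))) by (simpl; f_equal; field).
      apply is_lim_seq_scal_l. apply is_lim_seq_minus'; apply is_lim_seq_trigamma; lra. }
  apply is_lim_seq_unique in Hlim. apply is_lim_seq_unique in Hlim2.
  rewrite Hlim in Hlim2. now injection Hlim2.
Qed.

(** * The integral of (1 - x^2) log x / (1 + x^4) *)

Lemma ex_derive_continuity_pt (f : R -> R) (x : R) : ex_derive f x -> continuity_pt f x.
Proof.
  intros H. apply continuity_pt_filterlim.
  now apply ex_derive_continuous_R.
Qed.

Lemma sqrt2_sqr : sqrt 2 * sqrt 2 = 2.
Proof. apply sqrt_sqrt. lra. Qed.

Lemma sqrt2_pos : 0 < sqrt 2.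
Proof. apply sqrt_lt_R0. lra. Qed.

(** Unrelated to the digamma function: the primitive of (1 - x^2) / (1 + x^4) that vanishes at 0. *)
Definition Psi (x : R) : R :=
  (ln (x ^ 2 + sqrt 2 * x + 1) - ln (x ^ 2 - sqrt 2 * x + 1)) / (2 * sqrt 2).

Lemma one_add_pow4_pos (x : R) : 0 < 1 + x ^ 4.
Proof.
  replace (x ^ 4) with ((x ^ 2) ^ 2) by ring. generalize (pow2_ge_0 (x ^ 2)). lra.
Qed.

Lemma quadratic_plus_pos (x : R) : 0 < x ^ 2 + sqrt 2 * x + 1.
Proof.
  assert (H := sqrt2_sqr). assert (H2 := pow2_ge_0 (x + sqrt 2 / 2)). simpl in *. nra.
Qed.

Lemma quadratic_minus_pos (x : R) : 0 < x ^ 2 - sqrt 2 * x + 1.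
Proof.
  assert (H := quadratic_plus_pos (- x)). nra.
Qed.

Lemma pow4_add_one_factor (x : R) :
  x ^ 4 + 1 = (x ^ 2 + sqrt 2 * x + 1) * (x ^ 2 - sqrt 2 * x + 1).
Proof. ring [sqrt2_sqr]. Qed.

Lemma is_derive_Psi (x : R) : is_derive Psi x ((1 - x ^ 2) / (1 + x ^ 4)).
Proof.
  assert (Hs := sqrt2_pos). assert (Hss := sqrt2_sqr).
  assert (H1 := quadratic_plus_pos x). assert (H2 := quadratic_minus_pos x).
  assert (H4 := one_add_pow4_pos x).
  unfold Psi. auto_derive; [simpl in *; repeat split; lra|].
  assert (E := pow4_add_one_factor x). rewrite Rplus_comm in E.
  rewrite E. field [Hss]. simpl in *. repeat split; lra.
Qed.

(** Mean value theorem with a derivative in [0, 1]. This linear bound makes the boundary term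
    [Psi e * ln e] vanish as e -> 0. *)
Lemma Rabs_Psi_le (x : R) : 0 <= x <= 1 -> Rabs (Psi x) <= x.
Proof.
  intros Hx.
  destruct (MVT_gen Psi 0 x (fun t => (1 - t ^ 2) / (1 + t ^ 4))) as (c & Hc & E).
  - intros; apply is_derive_Psi.
  - intros t _. apply ex_derive_continuity_pt. eexists. apply is_derive_Psi.
  - rewrite Rmin_left, Rmax_right in Hc by lra.
    replace (Psi 0) with 0 in E.
    2:{ unfold Psi. replace (0 ^ 2 + sqrt 2 * 0 + 1) with (0 ^ 2 - sqrt 2 * 0 + 1) by ring.
        unfold Rdiv. ring. }
    rewrite !Rminus_0_r in E. rewrite E.
    assert (H4 := one_add_pow4_pos c).
    assert (Hq : 0 <= (1 - c ^ 2) / (1 + c ^ 4) <= 1).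
    { assert (0 <= c ^ 4) by (apply pow_le; lra). assert (0 <= c ^ 2 <= 1) by nra.
      split; [apply Rdiv_le_0_compat; lra|].
      apply Rmult_le_reg_r with (1 + c ^ 4); [assumption|].
      unfold Rdiv. rewrite Rmult_assoc, Rinv_l by lra. lra. }
    rewrite Rabs_pos_eq; nra.
Qed.

(** A primitive of 2 sqrt 2 Psi y / y. Indeed 2 sqrt 2 Psi y is the increment of ln (1 - 2 y cos t +
    y^2) from t = pi/4 to 3 pi/4, hence the integral over t of 2 y sin t / (1 - 2 y cos t + y^2),
    and dividing by y leaves the y-derivative of the integrand used here. *)
Definition arctan_integral (y : R) : R :=
  RInt (fun t => 2 * atan ((y - cos t) / sin t)) (PI / 4) (3 * PI / 4).

Lemma sin_pos_mid (t : R) : PI / 4 <= t <= 3 * PI / 4 -> 0 < sin t.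
Proof. intros Ht. assert (HP := PI_RGT_0). apply sin_gt_0; lra. Qed.

Lemma continuous_arctan_integrand (y t : R) : 0 < sin t ->
  continuous (fun t => 2 * atan ((y - cos t) / sin t)) t.
Proof.
  intros Ht. apply ex_derive_continuous_R.
  auto_derive. lra.
Qed.

Lemma is_derive_arctan_integrand (y t : R) :
  is_derive (fun y => 2 * atan ((y - cos t) / sin t)) y
    (2 * sin t / (1 - 2 * y * cos t + y ^ 2)).
Proof.
  assert (Ht := sin2_cos2 t). unfold Rsqr in Ht.
  destruct (Req_dec (sin t) 0) as [H0|H0].
  (* Since [/ 0 = 0], the function is constant and the claimed derivative is 0, so the formula holds
     for every [t]. *)
  - rewrite H0. unfold Rdiv. rewrite Rinv_0.
    auto_derive; [exact I|ring].
  - auto_derive; [exact I|].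
    replace (1 - 2 * y * cos t + y ^ 2) with ((y - cos t) ^ 2 + sin t ^ 2) by nra.
    assert (0 < sin t ^ 2) by (apply pow2_gt_0; assumption).
    assert (0 <= (y - cos t) ^ 2) by apply pow2_ge_0.
    field. split; [lra|assumption].
Qed.

Lemma cos_quadratic_pos (y t : R) : 0 < sin t -> 0 < 1 - 2 * y * cos t + y ^ 2.
Proof.
  intros Hs. assert (Ht := sin2_cos2 t). unfold Rsqr in Ht.
  replace (1 - 2 * y * cos t + y ^ 2) with ((y - cos t) ^ 2 + sin t ^ 2) by nra.
  assert (0 <= (y - cos t) ^ 2) by apply pow2_ge_0. nra.
Qed.

(** Covers y = 0 as well, which supplies the continuity there that the limit e -> 0 requires. *)
Lemma is_derive_arctan_integral_aux (y : R) :
  is_derive arctan_integral y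
    (RInt (fun t => 2 * sin t / (1 - 2 * y * cos t + y ^ 2)) (PI / 4) (3 * PI / 4)).
Proof.
  assert (HP := PI_RGT_0).
  rewrite <- (RInt_ext (fun t => Derive (fun u => 2 * atan ((u - cos t) / sin t)) y))
    by (intros t _; apply is_derive_unique, is_derive_arctan_integrand).
  apply (is_derive_RInt_param (fun y t => 2 * atan ((y - cos t) / sin t))).
  - apply filter_forall. intros u t _. eexists. apply is_derive_arctan_integrand.
  - intros t Ht. rewrite Rmin_left, Rmax_right in Ht by lra.
    apply sin_pos_mid in Ht.
    apply (continuity_2d_pt_ext (fun u v => 2 * sin v * / (1 - 2 * u * cos v + u * u))).
    + intros u v. symmetry. replace (u * u) with (u ^ 2) by ring.
      apply is_derive_unique, is_derive_arctan_integrand.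
    + assert (Hsin : continuity_2d_pt (fun _ v => sin v) y t)
        by (apply (continuity_1d_2d_pt_comp sin (fun _ v => v));
            [apply continuity_sin|apply continuity_2d_pt_id2]).
      assert (Hcos : continuity_2d_pt (fun _ v => cos v) y t)
        by (apply (continuity_1d_2d_pt_comp cos (fun _ v => v));
            [apply continuity_cos|apply continuity_2d_pt_id2]).
      apply continuity_2d_pt_mult; [apply continuity_2d_pt_mult|apply continuity_2d_pt_inv].
      * apply continuity_2d_pt_const.
      * exact Hsin.
      * apply continuity_2d_pt_plus; [apply continuity_2d_pt_minus|apply continuity_2d_pt_mult].
        -- apply continuity_2d_pt_const.
        -- apply continuity_2d_pt_mult; [apply continuity_2d_pt_mult|exact Hcos].
           ++ apply continuity_2d_pt_const.
           ++ apply continuity_2d_pt_id1.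
        -- apply continuity_2d_pt_id1.
        -- apply continuity_2d_pt_id1.
      * assert (H := cos_quadratic_pos y t Ht). simpl in H. lra.
  - apply filter_forall. intros u.
    apply (ex_RInt_continuous (V := R_CompleteNormedModule)). intros t Ht.
    rewrite Rmin_left, Rmax_right in Ht by lra.
    apply continuous_arctan_integrand, sin_pos_mid, Ht.
Qed.

Lemma cos_3PI4' : cos (3 * PI / 4) = - (sqrt 2 / 2).
Proof.
  replace (3 * PI / 4) with (3 * (PI / 4)) by field.
  rewrite cos_3PI4. assert (H := sqrt2_pos). assert (H2 := sqrt2_sqr).
  apply Rmult_eq_reg_r with (sqrt 2); [|lra].
  field_simplify; [|lra]. simpl. lra.
Qed.

Lemma cos_PI4' : cos (PI / 4) = sqrt 2 / 2.
Proof.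
  rewrite cos_PI4. assert (H := sqrt2_pos). assert (H2 := sqrt2_sqr).
  apply Rmult_eq_reg_r with (sqrt 2); [|lra].
  field_simplify; [|lra]. simpl. lra.
Qed.

Lemma is_derive_arctan_integral (y : R) : 0 < y ->
  is_derive arctan_integral y (2 * sqrt 2 * Psi y / y).
Proof.
  intros Hy. assert (HP := PI_RGT_0).
  replace (2 * sqrt 2 * Psi y / y) with
    (RInt (fun t => 2 * sin t / (1 - 2 * y * cos t + y ^ 2)) (PI / 4) (3 * PI / 4));
    [apply is_derive_arctan_integral_aux|].
  apply (is_RInt_unique (V := R_CompleteNormedModule)).
  set (F := fun t => ln (1 - 2 * y * cos t + y ^ 2) / y).
  replace (2 * sqrt 2 * Psi y / y) with (minus (F (3 * PI / 4)) (F (PI / 4))).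
  2:{ unfold F, minus, plus, opp; simpl plus. rewrite cos_3PI4', cos_PI4'.
      unfold Psi. assert (Hs := sqrt2_pos).
      replace (1 - 2 * y * - (sqrt 2 / 2) + y ^ 2) with (y ^ 2 + sqrt 2 * y + 1) by field.
      replace (1 - 2 * y * (sqrt 2 / 2) + y ^ 2) with (y ^ 2 - sqrt 2 * y + 1) by field.
      simpl. field. lra. }
  apply (is_RInt_derive (V := R_CompleteNormedModule)); intros t Ht;
    rewrite Rmin_left, Rmax_right in Ht by lra;
    assert (H := cos_quadratic_pos y t (sin_pos_mid t Ht)).
  - unfold F. auto_derive; [simpl in *; lra|]. simpl in *. field. split; lra.
  - apply ex_derive_continuous_R.
    auto_derive. simpl in *; lra.
Qed.

(** Both ends are elementary: (1 - cos t) / sin t = tan (t/2) makes the integrand t, and - cos t /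
    sin t = tan (t - pi/2) makes it 2 t - pi. *)
Lemma arctan_integral_diff : arctan_integral 1 - arctan_integral 0 = PI ^ 2 / 4.
Proof.
  assert (HP := PI_RGT_0).
  assert (H1 : is_RInt (fun t => t) (PI / 4) (3 * PI / 4) (arctan_integral 1)).
  { apply (is_RInt_ext (fun t => 2 * atan ((1 - cos t) / sin t))).
    - intros t Ht. rewrite Rmin_left, Rmax_right in Ht by lra.
      replace ((1 - cos t) / sin t) with (tan (t / 2)).
      + rewrite atan_tan by lra. change (2 * (t / 2) = t :> R). field.
      + unfold tan. replace (cos t) with (cos (2 * (t / 2))) by (f_equal; field).
        replace (sin t) with (sin (2 * (t / 2))) by (f_equal; field).
        rewrite cos_2a_sin, sin_2a. field.
        split; apply Rgt_not_eq; [apply cos_gt_0|apply sin_gt_0]; lra.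
    - apply (RInt_correct (V := R_CompleteNormedModule)).
      apply (ex_RInt_continuous (V := R_CompleteNormedModule)). intros t Ht.
      rewrite Rmin_left, Rmax_right in Ht by lra.
      apply continuous_arctan_integrand, sin_pos_mid, Ht. }
  assert (H0 : is_RInt (fun t => 2 * t - PI) (PI / 4) (3 * PI / 4) (arctan_integral 0)).
  { apply (is_RInt_ext (fun t => 2 * atan ((0 - cos t) / sin t))).
    - intros t Ht. rewrite Rmin_left, Rmax_right in Ht by lra.
      replace ((0 - cos t) / sin t) with (tan (t - PI / 2)).
      + rewrite atan_tan by lra. change (2 * (t - PI / 2) = 2 * t - PI :> R). field.
      + unfold tan. rewrite sin_minus, cos_minus, sin_PI2, cos_PI2. field.
        assert (0 < sin t) by (apply sin_gt_0; lra). lra.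
    - apply (RInt_correct (V := R_CompleteNormedModule)).
      apply (ex_RInt_continuous (V := R_CompleteNormedModule)). intros t Ht.
      rewrite Rmin_left, Rmax_right in Ht by lra.
      apply continuous_arctan_integrand, sin_pos_mid, Ht. }
  assert (H2 : is_RInt (fun t => t - (2 * t - PI)) (PI / 4) (3 * PI / 4)
    (arctan_integral 1 - arctan_integral 0))
    by exact (is_RInt_minus (V := R_NormedModule) _ _ _ _ _ _ H1 H0).
  assert (H3 : is_RInt (fun t => t - (2 * t - PI)) (PI / 4) (3 * PI / 4)
    (PI * (3 * PI / 4) - (3 * PI / 4) ^ 2 / 2 - (PI * (PI / 4) - (PI / 4) ^ 2 / 2))).
  { apply (is_RInt_derive (V := R_CompleteNormedModule) (fun t => PI * t - t ^ 2 / 2));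
      intros t _.
    - auto_derive; [exact I|]. field.
    - apply ex_derive_continuous_R.
      auto_derive. exact I. }
  apply (is_RInt_unique (V := R_CompleteNormedModule)) in H2.
  apply (is_RInt_unique (V := R_CompleteNormedModule)) in H3.
  rewrite H2 in H3. rewrite H3. field.
Qed.

(** Integration by parts against [Psi]; what remains, Psi t / t, has the primitive [arctan_integral]
    over 2 sqrt 2. *)
Lemma RInt_one_minus_sq_mul_ln (e : R) : 0 < e <= 1 ->
  is_RInt (fun t => (1 - t ^ 2) / (1 + t ^ 4) * ln t) e 1
    (- (arctan_integral 1 - arctan_integral e) / (2 * sqrt 2) - Psi e * ln e).
Proof.
  intros He. assert (Hs := sqrt2_pos).
  set (F := fun t => Psi t * ln t - arctan_integral t / (2 * sqrt 2)).
  replace (_ - _) with (minus (F 1) (F e)).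
  2:{ unfold F, minus, plus, opp; simpl. rewrite ln_1. field. lra. }
  apply (is_RInt_derive (V := R_CompleteNormedModule)); intros t Ht;
    rewrite Rmin_left, Rmax_right in Ht by lra.
  - unfold F.
    replace ((1 - t ^ 2) / (1 + t ^ 4) * ln t) with
      ((1 - t ^ 2) / (1 + t ^ 4) * ln t + Psi t * / t
       - / (2 * sqrt 2) * (2 * sqrt 2 * Psi t / t)).
    2:{ field. split; [|split]; try lra. apply Rgt_not_eq, one_add_pow4_pos. }
    apply (is_derive_minus (V := R_NormedModule) (fun t => Psi t * ln t)).
    + apply (is_derive_mult (K := R_AbsRing)).
      * apply is_derive_Psi.
      * apply is_derive_ln; lra.
      * intros; apply Rmult_comm.
    + apply (is_derive_ext (fun t => scal (/ (2 * sqrt 2)) (arctan_integral t))).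
      * intros u. unfold scal; simpl; unfold mult; simpl. unfold Rdiv. ring.
      * apply is_derive_scal.
        apply is_derive_arctan_integral. lra.
  - apply ex_derive_continuous_R.
    assert (H := one_add_pow4_pos t). auto_derive. simpl in *. repeat split; lra.
Qed.

Lemma is_lim_seq_one_minus_sq_mul_ln (d : nat -> R) :
  (forall n, 0 < d n <= 1) -> is_lim_seq d 0 ->
  is_lim_seq (fun n => RInt (fun t => (1 - t ^ 2) / (1 + t ^ 4) * ln t) (d n ^ 2) 1)
    (- PI ^ 2 / (8 * sqrt 2)).
Proof.
  intros Hd Hlim. assert (Hs := sqrt2_pos).
  assert (Hd2 : forall n, 0 < d n ^ 2 <= 1) by (intros n; specialize (Hd n); nra).
  apply (is_lim_seq_ext (fun n => - (arctan_integral 1 - arctan_integral (d n ^ 2)) / (2 * sqrt 2)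
     - Psi (d n ^ 2) * ln (d n ^ 2))).
  { intros n. symmetry. apply (is_RInt_unique (V := R_CompleteNormedModule)).
    now apply RInt_one_minus_sq_mul_ln. }
  replace (- PI ^ 2 / (8 * sqrt 2)) with
    (- (arctan_integral 1 - arctan_integral 0) / (2 * sqrt 2) - 0)
    by (rewrite arctan_integral_diff; field; lra).
  apply is_lim_seq_minus'.
  - apply (is_lim_seq_continuous
      (fun x => - (arctan_integral 1 - arctan_integral (x ^ 2)) / (2 * sqrt 2)) d 0) in Hlim.
    + replace (0 ^ 2) with 0 in Hlim by ring. exact Hlim.
    + apply ex_derive_continuity_pt.
      assert (ex_derive arctan_integral (0 ^ 2)) by (eexists; exact (is_derive_arctan_integral_aux (0 ^ 2))).
      auto_derive. replace (0 * (0 * 1)) with (0 ^ 2) by ring. auto.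
  - apply is_lim_seq_abs_le with (fun n => 2 * d n).
    + intros n. rewrite Rminus_0_r, Rabs_mult. specialize (Hd n). specialize (Hd2 n).
      replace (ln (d n ^ 2)) with (2 * ln (d n)) by (rewrite ln_pow by lra; simpl; ring).
      assert (H1 := Rabs_Psi_le (d n ^ 2)). assert (H2 := Rabs_mul_ln_le_1 (d n) Hd).
      rewrite Rabs_mult, (Rabs_pos_eq (d n)) in H2 by lra.
      rewrite Rabs_mult, (Rabs_pos_eq 2) by lra.
      assert (H3 := Rabs_pos (ln (d n))).
      apply Rle_trans with (d n ^ 2 * (2 * Rabs (ln (d n)))); [|simpl; nra].
      apply Rmult_le_compat_r; [lra|]. apply H1; lra.
    + replace (Finite 0) with (Rbar_mult 2 0) by (simpl; f_equal; ring).
      now apply is_lim_seq_scal_l.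
Qed.

(** * Logarithms of Poisson kernels *)

Lemma poisson_kernel_bounds (r t : R) :
  (1 - Rabs r) ^ 2 <= 1 - 2 * r * cos t + r ^ 2 <= (1 + Rabs r) ^ 2.
Proof.
  assert (H : Rabs (r * cos t) <= Rabs r).
  { rewrite Rabs_mult. assert (Hc := Rabs_le _ _ (COS_bound t)).
    assert (H0 := Rabs_pos r). rewrite <- (Rmult_1_r (Rabs r)) at 2.
    now apply Rmult_le_compat_l. }
  apply Rabs_le_between in H. assert (H2 := pow2_abs r). lra.
Qed.

Lemma poisson_kernel_pos (r t : R) : Rabs r < 1 -> 0 < 1 - 2 * r * cos t + r ^ 2.
Proof.
  intros Hr. apply Rlt_le_trans with (2 := proj1 (poisson_kernel_bounds r t)).
  apply pow_lt. lra.
Qed.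

Definition ln_poisson (r t : R) : R := ln (1 - 2 * r * cos t + r ^ 2).

Lemma continuous_ln_poisson (r t : R) : Rabs r < 1 -> continuous (ln_poisson r) t.
Proof.
  intros Hr. apply ex_derive_continuous_R.
  assert (H := poisson_kernel_pos r t Hr). unfold ln_poisson. auto_derive.
  simpl in *. lra.
Qed.

Lemma ex_RInt_ln_poisson (r a b : R) : Rabs r < 1 -> ex_RInt (ln_poisson r) a b.
Proof.
  intros Hr. apply (ex_RInt_continuous (V := R_CompleteNormedModule)).
  intros; now apply continuous_ln_poisson.
Qed.

Lemma RInt_reflect (f : R -> R) (a b c : R) : ex_RInt f (c - a) (c - b) ->
  RInt (fun t => f (c - t)) a b = RInt f (c - b) (c - a).
Proof.
  intros H.
  assert (H1 := RInt_comp_lin f (-1) c a b).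
  replace (-1 * a + c) with (c - a) in H1 by ring.
  replace (-1 * b + c) with (c - b) in H1 by ring.
  specialize (H1 H).
  rewrite <- (opp_RInt_swap f (c - a) (c - b)) by exact H.
  rewrite <- H1, <- (RInt_opp (V := R_CompleteNormedModule)).
  - apply RInt_ext. intros t _. unfold opp, scal; simpl; unfold mult; simpl.
    replace (-1 * t + c) with (c - t) by ring. ring.
  - apply (ex_RInt_comp_lin (V := R_NormedModule) f (-1) c a b).
    replace (-1 * a + c) with (c - a) by ring.
    replace (-1 * b + c) with (c - b) by ring. exact H.
Qed.

(** The kernels for r and -r at t multiply to the kernel for r^2 at 2 t. The reflection t -> pi - t
    shows that r and -r have the same integral, and t -> 2 pi - t folds [pi, 2 pi] back onto
    [0, pi]. *)
Lemma RInt_ln_poisson_double (r : R) : Rabs r < 1 ->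
  2 * RInt (ln_poisson r) 0 PI = RInt (ln_poisson (r ^ 2)) 0 PI.
Proof.
  intros Hr.
  assert (Hn : Rabs (- r) < 1) by now rewrite Rabs_Ropp.
  assert (H2 : Rabs (r ^ 2) < 1).
  { rewrite <- RPow_abs. assert (H := Rabs_pos r). simpl. nra. }
  assert (Hrefl : RInt (ln_poisson (- r)) 0 PI = RInt (ln_poisson r) 0 PI).
  { assert (H := RInt_reflect (ln_poisson r) 0 PI PI (ex_RInt_ln_poisson r _ _ Hr)).
    replace (PI - PI) with 0 in H by ring. rewrite Rminus_0_r in H. rewrite <- H.
    apply RInt_ext. intros t _. unfold ln_poisson. f_equal.
    rewrite Rtrigo_facts.cos_pi_minus. ring. }
  assert (Hper : RInt (ln_poisson (r ^ 2)) PI (2 * PI) = RInt (ln_poisson (r ^ 2)) 0 PI).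
  { assert (H := RInt_reflect (ln_poisson (r ^ 2)) PI (2 * PI) (2 * PI)
      (ex_RInt_ln_poisson (r ^ 2) _ _ H2)).
    replace (2 * PI - PI) with PI in H by ring.
    replace (2 * PI - 2 * PI) with 0 in H by ring. rewrite <- H.
    apply RInt_ext. intros t _. unfold ln_poisson. do 2 f_equal. f_equal.
    rewrite cos_minus, cos_2PI, sin_2PI. ring. }
  assert (Hlin := RInt_comp_lin (ln_poisson (r ^ 2)) 2 0 0 PI).
  rewrite Rmult_0_r, !Rplus_0_r in Hlin.
  specialize (Hlin (ex_RInt_ln_poisson _ _ _ H2)).
  rewrite <- (RInt_Chasles (ln_poisson (r ^ 2)) 0 PI (2 * PI)), Hper in Hlin
    by now apply ex_RInt_ln_poisson.
  assert (Hsum : RInt (fun t => ln_poisson r t + ln_poisson (- r) t) 0 PI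
    = RInt (ln_poisson r) 0 PI + RInt (ln_poisson (- r)) 0 PI).
  { apply (RInt_plus (V := R_CompleteNormedModule)); now apply ex_RInt_ln_poisson. }
  rewrite Hrefl in Hsum.
  assert (Heq : RInt (fun y => scal 2 (ln_poisson (r ^ 2) (2 * y + 0))) 0 PI
    = 2 * RInt (fun t => ln_poisson r t + ln_poisson (- r) t) 0 PI).
  { transitivity (RInt (fun t => scal 2 (ln_poisson r t + ln_poisson (- r) t)) 0 PI).
    - apply RInt_ext. intros t _. f_equal. unfold ln_poisson.
      rewrite <- ln_mult by now apply poisson_kernel_pos. f_equal.
      rewrite Rplus_0_r, cos_2a_cos. ring.
    - apply (RInt_scal (V := R_CompleteNormedModule)).
      apply (ex_RInt_plus (V := R_NormedModule)); now apply ex_RInt_ln_poisson. }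
  apply eq_sym, (fun H => eq_trans H Heq) in Hlin. rewrite Hsum in Hlin.
  set (I2 := RInt (ln_poisson (r ^ 2)) 0 PI) in *. change (I2 + I2 = 2 * (RInt (ln_poisson r) 0 PI + RInt (ln_poisson r) 0 PI)) in Hlin. lra.
Qed.

(* [2 I(r) = I(r^2)] iterates to [I(r) = I(r^(2^n)) / 2^n], which tends to [0]. *)
Lemma RInt_ln_poisson (r : R) : Rabs r < 1 -> RInt (ln_poisson r) 0 PI = 0.
Proof.
  intros Hr. assert (HP := PI_RGT_0). assert (Hr0 := Rabs_pos r).
  set (M := PI * (ln 4 - ln ((1 - Rabs r) ^ 2))).
  (* Quantified over all |s| <= |r| with a single M, so that the induction can pass from s to
     s^2. *)
  assert (H : forall n s, Rabs s <= Rabs r -> Rabs (RInt (ln_poisson s) 0 PI) <= M * (/ 2) ^ n).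
  { induction n as [|n IH]; intros s Hs.
    - rewrite Rmult_1_r. unfold M. rewrite <- (Rminus_0_r PI) at 2.
      apply abs_RInt_le_const; [lra|apply ex_RInt_ln_poisson; lra|].
      intros t _. assert (Hb := poisson_kernel_bounds s t).
      assert (H0 := Rabs_pos s).
      assert (Hlo : 0 < (1 - Rabs r) ^ 2) by (apply pow_lt; lra).
      assert (H1 : ln ((1 - Rabs r) ^ 2) <= ln_poisson s t)
        by (apply ln_le; [assumption|nra]).
      assert (H2 : ln_poisson s t <= ln 4) by (apply ln_le; nra).
      assert (H3 : 0 <= ln 4) by (rewrite <- ln_1; apply ln_le; lra).
      assert (H4 : ln ((1 - Rabs r) ^ 2) <= 0) by (rewrite <- ln_1; apply ln_le; nra).
      apply Rabs_le. lra.
    - assert (Hs2 : Rabs (s ^ 2) <= Rabs r).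
      { rewrite <- RPow_abs. assert (H0 := Rabs_pos s). simpl. nra. }
      specialize (IH _ Hs2). rewrite <- RInt_ln_poisson_double in IH by lra.
      rewrite Rabs_mult, (Rabs_pos_eq 2) in IH by lra. simpl. lra. }
  assert (Hlim : is_lim_seq (fun n => M * (/ 2) ^ n) 0).
  { replace (Finite 0) with (Rbar_mult M 0) by (simpl; f_equal; ring).
    apply is_lim_seq_scal_l, is_lim_seq_geom. rewrite Rabs_pos_eq; lra. }
  assert (Hle : Rbar_le (Rabs (RInt (ln_poisson r) 0 PI)) 0).
  { refine (is_lim_seq_le _ _ _ _ _ (is_lim_seq_const _) Hlim).
    intros n. apply H. lra. }
  simpl in Hle. generalize (Rabs_pos (RInt (ln_poisson r) 0 PI)). intros H0.
  apply Rabs_eq_0. lra.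
Qed.

(** * The substitution theta *)

Definition weight (x : R) : R := (x ^ 2 + 1) / (x ^ 4 + 1).

Lemma pow4_add_one_pos (x : R) : 0 < x ^ 4 + 1.
Proof. rewrite Rplus_comm. apply one_add_pow4_pos. Qed.

Lemma weight_bounds (x : R) : 0 <= x <= 1 -> 0 <= weight x <= 2.
Proof.
  intros Hx. assert (H := pow4_add_one_pos x). unfold weight.
  assert (0 <= x ^ 4) by (apply pow_le; lra).
  split; [apply Rdiv_le_0_compat; nra|].
  apply Rmult_le_reg_r with (x ^ 4 + 1); [assumption|].
  unfold Rdiv. rewrite Rmult_assoc, Rinv_l by lra. nra.
Qed.

Lemma continuous_weight (x : R) : continuous weight x.
Proof.
  apply ex_derive_continuous_R.
  assert (H := pow4_add_one_pos x). unfold weight. auto_derive. simpl in *. lra.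
Qed.

(** By partial fractions [weight] is half the sum of 1 / (x^2 + sqrt 2 x + 1) and 1 / (x^2 - sqrt 2
    x + 1); each arctangent integrates one of them. *)
Definition theta (x : R) : R := 2 * (atan (sqrt 2 * x + 1) + atan (sqrt 2 * x - 1)).

Lemma is_derive_theta (x : R) : is_derive theta x (2 * sqrt 2 * weight x).
Proof.
  assert (Hss := sqrt2_sqr).
  assert (H1 := quadratic_plus_pos x). assert (H2 := quadratic_minus_pos x).
  unfold theta, weight. auto_derive; [exact I|].
  assert (E := pow4_add_one_factor x).
  rewrite E.
  replace (1 + (sqrt 2 * x + 1) * ((sqrt 2 * x + 1) * 1)) with (2 * (x ^ 2 + sqrt 2 * x + 1)) by (ring [Hss]).
  replace (1 + (sqrt 2 * x + - (1)) * ((sqrt 2 * x + - (1)) * 1)) with (2 * (x ^ 2 - sqrt 2 * x + 1)) by (ring [Hss]).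
  field. lra.
Qed.

Lemma theta_0 : theta 0 = 0.
Proof.
  unfold theta. rewrite Rmult_0_r, Rplus_0_l, Rminus_0_l, atan_opp. ring.
Qed.

Lemma theta_1 : theta 1 = PI.
Proof.
  assert (Hs := sqrt2_pos). assert (Hss := sqrt2_sqr).
  unfold theta. rewrite Rmult_1_r.
  replace (sqrt 2 - 1) with (/ (sqrt 2 + 1)) by (field_simplify_eq [Hss]; lra).
  rewrite atan_inv by lra. field.
Qed.

(** Divided by 1 + x^4, the factor with parameter a becomes ((a^2 + 2) - (a^2 - 2) cos theta) / 4.
    It is a multiple of a Poisson kernel when 2 r / (1 + r^2) = (a^2 - 2) / (a^2 + 2), solved by r =
    (a - sqrt 2) / (a + sqrt 2). *)
Lemma cos_theta (x : R) : cos (theta x) = 1 - 4 * x ^ 2 / (x ^ 4 + 1).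
Proof.
  assert (Hss := sqrt2_sqr).
  assert (Hc : forall u, cos (2 * atan u) = (1 - u ^ 2) / (1 + u ^ 2)
    /\ sin (2 * atan u) = 2 * u / (1 + u ^ 2)).
  { intros u. assert (Hu := pow2_ge_0 u).
    assert (Hq : 0 < sqrt (1 + u²)) by (apply sqrt_lt_R0; unfold Rsqr; nra).
    assert (Hqq : sqrt (1 + u²) * sqrt (1 + u²) = 1 + u ^ 2)
      by (rewrite sqrt_sqrt; unfold Rsqr; nra).
    rewrite cos_2a_sin, sin_2a, sin_atan, cos_atan, <- Hqq.
    split; field_simplify_eq; try lra. }
  unfold theta. rewrite Rmult_plus_distr_l, cos_plus.
  destruct (Hc (sqrt 2 * x + 1)) as [-> ->]. destruct (Hc (sqrt 2 * x - 1)) as [-> ->].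
  assert (H1 := quadratic_plus_pos x). assert (H2 := quadratic_minus_pos x).
  assert (E := pow4_add_one_factor x).
  replace (1 + (sqrt 2 * x + 1) ^ 2) with (2 * (x ^ 2 + sqrt 2 * x + 1)) by (ring [Hss]).
  replace (1 + (sqrt 2 * x - 1) ^ 2) with (2 * (x ^ 2 - sqrt 2 * x + 1)) by (ring [Hss]).
  rewrite E. field [Hss]. lra.
Qed.

Lemma is_RInt_weight : is_RInt weight 0 1 (PI / (2 * sqrt 2)).
Proof.
  assert (Hs := sqrt2_pos).
  replace (PI / (2 * sqrt 2)) with (minus (theta 1 / (2 * sqrt 2)) (theta 0 / (2 * sqrt 2))).
  2:{ rewrite theta_0, theta_1. unfold minus, plus, opp; simpl. field. lra. }
  apply (is_RInt_derive (V := R_CompleteNormedModule) (fun x => theta x / (2 * sqrt 2))).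
  - intros x _. apply (is_derive_ext (fun x => scal (/ (2 * sqrt 2)) (theta x))).
    + intros u. unfold scal; simpl; unfold mult; simpl. unfold Rdiv. ring.
    + replace (weight x) with (/ (2 * sqrt 2) * (2 * sqrt 2 * weight x)) by (field; lra).
      apply is_derive_scal, is_derive_theta.
  - intros x _. apply continuous_weight.
Qed.

(** An unknown constant until [base_integral_eq]: J is this integral minus (pi / sqrt 2) (3/2) ln
    2. *)
Definition base_integral : R := RInt (fun x => weight x * ln (1 + x ^ 4)) 0 1.

(* With [r = (a - sqrt 2) / (a + sqrt 2)] the argument of the logarithm is
   [(1 + x^4) * ((a + sqrt 2)^2 / 8) * (1 - 2 r cos (theta x) + r^2)]. *)
Lemma is_RInt_weight_ln_aux (a : R) : 0 < a ->
  is_RInt (fun x => weight x * ln ((1 - x ^ 2) ^ 2 + a ^ 2 * x ^ 2)) 0 1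
    (base_integral + PI / sqrt 2 * (ln (sqrt 2 + a) - 3 / 2 * ln 2)).
Proof.
  intros Ha. assert (Hs := sqrt2_pos). assert (Hss := sqrt2_sqr).
  set (r := (a - sqrt 2) / (a + sqrt 2)).
  assert (Hr : Rabs r < 1).
  { apply Rabs_def1; apply Rmult_lt_reg_r with (a + sqrt 2); try lra;
      unfold r, Rdiv; rewrite Rmult_assoc, Rinv_l; lra. }
  assert (H1 : is_RInt (fun x => weight x * ln (1 + x ^ 4)) 0 1 base_integral).
  { apply (RInt_correct (V := R_CompleteNormedModule)).
    apply (ex_RInt_continuous (V := R_CompleteNormedModule)). intros x _.
    apply (continuous_mult (K := R_AbsRing)); [apply continuous_weight|].
    apply ex_derive_continuous_R.
    assert (H := one_add_pow4_pos x). auto_derive. simpl in *. lra. }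
  assert (H2 := is_RInt_scal (V := R_NormedModule) _ _ _ (2 * ln (sqrt 2 + a) - 3 * ln 2) _
    is_RInt_weight).
  assert (H3 : is_RInt (fun x => scal (2 * sqrt 2 * weight x) (ln_poisson r (theta x))) 0 1 0).
  { assert (H := is_RInt_comp (V := R_CompleteNormedModule) (ln_poisson r) theta
      (fun x => 2 * sqrt 2 * weight x) 0 1).
    rewrite theta_0, theta_1, (RInt_ln_poisson r Hr) in H. apply H.
    - intros x _. now apply continuous_ln_poisson.
    - intros x _. split; [apply is_derive_theta|].
      apply (continuous_scal_r (V := R_NormedModule) (2 * sqrt 2) weight), continuous_weight. }
  assert (H4 := is_RInt_scal (V := R_NormedModule) _ _ _ (/ (2 * sqrt 2)) _ H3).
  assert (H5 := is_RInt_plus (V := R_NormedModule) _ _ _ _ _ _ H1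
    (is_RInt_plus (V := R_NormedModule) _ _ _ _ _ _ H2 H4)).
  replace (base_integral + PI / sqrt 2 * (ln (sqrt 2 + a) - 3 / 2 * ln 2)) with
    (plus base_integral (plus (scal (2 * ln (sqrt 2 + a) - 3 * ln 2) (PI / (2 * sqrt 2)))
       (scal (/ (2 * sqrt 2)) 0))).
  2:{ unfold plus, scal; simpl; unfold mult; simpl. field. lra. }
  revert H5. apply is_RInt_ext. intros x _.
  change (weight x * ln (1 + x ^ 4) + ((2 * ln (sqrt 2 + a) - 3 * ln 2) * weight x
    + / (2 * sqrt 2) * (2 * sqrt 2 * weight x * ln_poisson r (theta x)))
    = weight x * ln ((1 - x ^ 2) ^ 2 + a ^ 2 * x ^ 2)).
  assert (Hp := one_add_pow4_pos x).
  assert (Hk := poisson_kernel_pos r (theta x) Hr).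
  assert (E : (1 - x ^ 2) ^ 2 + a ^ 2 * x ^ 2 =
    (1 + x ^ 4) * ((sqrt 2 + a) ^ 2 / 2 ^ 3 * (1 - 2 * r * cos (theta x) + r ^ 2))).
  { rewrite cos_theta. unfold r. field [Hss]. lra. }
  rewrite E.
  assert (Hq : 0 < (sqrt 2 + a) ^ 2 / 2 ^ 3)
    by (apply Rdiv_lt_0_compat; apply pow_lt; lra).
  rewrite ln_mult by (try apply Rmult_lt_0_compat; assumption).
  rewrite ln_mult by assumption.
  rewrite ln_div_pos by (apply pow_lt; lra).
  rewrite !ln_pow by lra. unfold ln_poisson. simpl INR. simpl. field. lra.
Qed.

(** * The constant term *)

Lemma continuous_weight_mult (f : R -> R) (x : R) :
  ex_derive f x -> continuous (fun t => weight t * f t) x.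
Proof.
  intros H. apply (continuous_mult (K := R_AbsRing)); [apply continuous_weight|].
  now apply ex_derive_continuous_R.
Qed.

Lemma rescaled_quadratic_pos (e x : R) : 0 < e -> 0 < e ^ 2 * (1 - x ^ 2) ^ 2 + x ^ 2.
Proof.
  intros He. assert (0 < e ^ 2) by (apply pow_lt; lra).
  assert (0 <= (1 - x ^ 2) ^ 2) by apply pow2_ge_0.
  assert (0 <= x ^ 2) by apply pow2_ge_0.
  destruct (Req_dec x 0) as [->|Hx]; [simpl; nra|].
  assert (0 < x ^ 2) by now apply pow2_gt_0. nra.
Qed.

(** The integral for a = 1/e with 2 ln a subtracted from the logarithm: a -> infinity becomes e ->
    0, and the logarithm tends to 2 ln x. *)
Definition rescaled_integral (e : R) : R :=
  RInt (fun x => weight x * ln (e ^ 2 * (1 - x ^ 2) ^ 2 + x ^ 2)) 0 1.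

Lemma continuous_rescaled (e x : R) : 0 < e ->
  continuous (fun x => weight x * ln (e ^ 2 * (1 - x ^ 2) ^ 2 + x ^ 2)) x.
Proof.
  intros He. apply continuous_weight_mult.
  assert (H := rescaled_quadratic_pos e x He). auto_derive. simpl in *. lra.
Qed.

Lemma rescaled_integral_eq (e : R) : 0 < e ->
  rescaled_integral e = base_integral + PI / sqrt 2 * (ln (sqrt 2 * e + 1) - 3 / 2 * ln 2).
Proof.
  intros He. assert (Hs := sqrt2_pos).
  assert (Hi : 0 < / e) by now apply Rinv_0_lt_compat.
  apply (is_RInt_unique (V := R_CompleteNormedModule)).
  assert (H1 := is_RInt_weight_ln_aux (/ e) Hi).
  assert (H2 := is_RInt_scal (V := R_NormedModule) _ _ _ (2 * ln e) _ is_RInt_weight).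
  assert (H3 := is_RInt_plus (V := R_NormedModule) _ _ _ _ _ _ H1 H2).
  replace (base_integral + PI / sqrt 2 * (ln (sqrt 2 * e + 1) - 3 / 2 * ln 2)) with
    (plus (base_integral + PI / sqrt 2 * (ln (sqrt 2 + / e) - 3 / 2 * ln 2))
      (scal (2 * ln e) (PI / (2 * sqrt 2)))).
  2:{ replace (sqrt 2 * e + 1) with ((sqrt 2 + / e) * e) by (field; lra).
      rewrite ln_mult by lra.
      unfold plus, scal; simpl; unfold mult; simpl. field. lra. }
  revert H3. apply is_RInt_ext. intros x _.
  change (weight x * ln ((1 - x ^ 2) ^ 2 + (/ e) ^ 2 * x ^ 2) + 2 * ln e * weight x
    = weight x * ln (e ^ 2 * (1 - x ^ 2) ^ 2 + x ^ 2)).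
  assert (Hq := rescaled_quadratic_pos e x He).
  replace ((1 - x ^ 2) ^ 2 + (/ e) ^ 2 * x ^ 2) with
    ((e ^ 2 * (1 - x ^ 2) ^ 2 + x ^ 2) / e ^ 2) by (field; lra).
  rewrite ln_div_pos by (try apply pow_lt; assumption).
  rewrite ln_pow by assumption. simpl INR. ring.
Qed.

(** Cut at e = d^2. On [0, e] the logarithm is at most 2 ln 2 - 2 ln e in absolute value, costing at
    most 12 d since |d ln d| <= 1. On [e, 1] the integrands differ by at most 2 e^2 / x^2, whose
    integral is at most 2 e, hence at most 2 d. *)
Lemma rescaled_integral_approx (d : R) : 0 < d <= 1 / 2 ->
  Rabs (rescaled_integral (d ^ 2) - RInt (fun x => weight x * (2 * ln x)) (d ^ 2) 1) <= 14 * d.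
Proof.
  intros Hd. set (e := d ^ 2).
  assert (He : 0 < e <= d / 2) by (unfold e; nra).
  set (q := fun x => e ^ 2 * (1 - x ^ 2) ^ 2 + x ^ 2).
  assert (Hq : forall x, 0 < q x) by (intros; apply rescaled_quadratic_pos; lra).
  assert (Hex : forall a b, ex_RInt (fun x => weight x * ln (q x)) a b).
  { intros a b. apply (ex_RInt_continuous (V := R_CompleteNormedModule)).
    intros x _. apply continuous_rescaled. lra. }
  assert (Hex2 : ex_RInt (fun x => weight x * (2 * ln x)) e 1).
  { apply (ex_RInt_continuous (V := R_CompleteNormedModule)). intros x Hx.
    rewrite Rmin_left in Hx by lra.
    apply (continuous_weight_mult (fun x => 2 * ln x)). auto_derive. lra. }
  assert (Hsplit : rescaled_integral e = RInt (fun x => weight x * ln (q x)) 0 e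
    + RInt (fun x => weight x * ln (q x)) e 1).
  { symmetry. apply (RInt_Chasles (V := R_CompleteNormedModule)); apply Hex. }
  assert (Hsmall : Rabs (RInt (fun x => weight x * ln (q x)) 0 e) <= 12 * d).
  { apply Rle_trans with ((e - 0) * (2 * (2 * ln 2 - 2 * ln e))).
    - apply abs_RInt_le_const; [lra|apply Hex|].
      intros x Hx. assert (Hw := weight_bounds x).
      rewrite Rabs_mult, (Rabs_pos_eq (weight x)) by (apply Hw; lra).
      apply Rmult_le_compat; [apply Hw; lra|apply Rabs_pos|apply Hw; lra|].
      assert (Hx2 : 0 <= x ^ 2 <= e ^ 2) by nra.
      assert (He2 : 0 < e ^ 2 <= 1 / 16) by nra.
      assert (H1 : 1 / 4 <= (1 - x ^ 2) ^ 2 <= 1) by nra.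
      assert (H2 : (e / 2) ^ 2 <= q x) by (unfold q; nra).
      assert (H3 : q x <= 1) by (unfold q; nra).
      apply ln_le in H2; [|apply pow_lt; lra].
      apply ln_le in H3; [|apply Hq]. rewrite ln_1 in H3.
      rewrite ln_pow, ln_div_pos in H2 by lra. simpl INR in H2.
      apply Rabs_le. lra.
    - assert (Hln2 : ln 2 <= 1) by (generalize (ln_le_sub_1 2); lra).
      assert (H := Rabs_mul_ln_le_1 d). assert (H' : Rabs (d * ln d) <= 1) by (apply H; lra).
      apply Rabs_le_between in H'. unfold e. rewrite ln_pow by lra. simpl INR.
      rewrite Rminus_0_r.
      replace (d ^ 2 * (2 * (2 * ln 2 - 2 * ((1 + 1) * ln d)))) with
        (d * (4 * (d * ln 2) - 8 * (d * ln d))) by ring.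
      nra. }
  assert (Hlarge : Rabs (RInt (fun x => weight x * ln (q x) - weight x * (2 * ln x)) e 1) <= 2 * d).
  { assert (HI : is_RInt (fun x => 2 * e ^ 2 / x ^ 2) e 1 (2 * e - 2 * e ^ 2)).
    { replace (2 * e - 2 * e ^ 2) with (minus ((fun x => - 2 * e ^ 2 / x) 1) ((fun x => - 2 * e ^ 2 / x) e))
        by (unfold minus, plus, opp; simpl; field; lra).
      apply (is_RInt_derive (V := R_CompleteNormedModule)); intros x Hx;
        rewrite Rmin_left in Hx by lra.
      - auto_derive; [lra|]. field. lra.
      - apply ex_derive_continuous_R.
        auto_derive. assert (0 < x ^ 2) by (apply pow_lt; lra). simpl in *. lra. }
    assert (Hb : forall x, e < x < 1 ->
      0 <= weight x * ln (q x) - weight x * (2 * ln x) <= 2 * e ^ 2 / x ^ 2).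
    { intros x Hx. assert (Hw := weight_bounds x).
      assert (Hx2 : 0 < x ^ 2 <= 1) by nra.
      assert (H0 : 0 <= (1 - x ^ 2) ^ 2 <= 1) by nra.
      assert (He2 : 0 < e ^ 2) by nra.
      assert (H1 : ln (x ^ 2) <= ln (q x)) by (apply ln_le; [lra|unfold q; nra]).
      assert (H2 := ln_diff_le (x ^ 2) (q x)).
      assert (H3 : ln (x ^ 2) = 2 * ln x) by (rewrite ln_pow by lra; reflexivity).
      assert (H4 : (q x - x ^ 2) / x ^ 2 <= e ^ 2 / x ^ 2).
      { apply Rmult_le_compat_r; [left; apply Rinv_0_lt_compat; lra|]. unfold q. nra. }
      assert (Hi : 0 <= e ^ 2 / x ^ 2) by (apply Rdiv_le_0_compat; lra).
      assert (H5 : ln (q x) - 2 * ln x <= e ^ 2 / x ^ 2).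
      { rewrite <- H3. eapply Rle_trans; [apply H2; [lra|apply Hq]|exact H4]. }
      assert (Hw' : 0 <= weight x <= 2) by (apply Hw; lra).
      replace (2 * e ^ 2 / x ^ 2) with (2 * (e ^ 2 / x ^ 2)) by (field; lra).
      nra. }
    assert (Hex3 : ex_RInt (fun x => weight x * ln (q x) - weight x * (2 * ln x)) e 1)
      by (apply (ex_RInt_minus (V := R_NormedModule)); auto).
    assert (H0 := RInt_ge_0 _ e 1 ltac:(lra) Hex3 (fun x Hx => proj1 (Hb x Hx))).
    assert (H1 := is_RInt_le _ _ e 1 _ _ ltac:(lra)
      (RInt_correct (V := R_CompleteNormedModule) _ _ _ Hex3) HI (fun x Hx => proj2 (Hb x Hx))).
    assert (0 <= e ^ 2) by apply pow2_ge_0. rewrite Rabs_pos_eq by exact H0.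
    simpl in H1 |- *. lra. }
  assert (Hdiff : RInt (fun x => weight x * ln (q x) - weight x * (2 * ln x)) e 1
    = RInt (fun x => weight x * ln (q x)) e 1 - RInt (fun x => weight x * (2 * ln x)) e 1).
  { apply (RInt_minus (V := R_CompleteNormedModule)); auto. }
  rewrite Hsplit. rewrite Hdiff in Hlarge.
  replace (RInt (fun x => weight x * ln (q x)) 0 e + RInt (fun x => weight x * ln (q x)) e 1 -
    RInt (fun x => weight x * (2 * ln x)) e 1) with
    (RInt (fun x => weight x * ln (q x)) 0 e + (RInt (fun x => weight x * ln (q x)) e 1 -
    RInt (fun x => weight x * (2 * ln x)) e 1)) by ring.
  eapply Rle_trans; [apply Rabs_triang|]. lra.
Qed.

(** From 1 + t^2 = 2 t^2 + (1 - t^2). The part with t^2 ln t is continuous at 0 and is completed to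
    [0, 1]; the other stays truncated at e. *)
Lemma RInt_weight_ln_split (e : R) : 0 < e <= 1 ->
  RInt (fun x => weight x * (2 * ln x)) e 1 =
  4 * RInt (fun t => t ^ 2 * ln t / (1 + t ^ 4)) 0 1
  - 4 * RInt (fun t => t ^ 2 * ln t / (1 + t ^ 4)) 0 e
  + 2 * RInt (fun t => (1 - t ^ 2) / (1 + t ^ 4) * ln t) e 1.
Proof.
  intros He. set (f := fun t => t ^ 2 * ln t / (1 + t ^ 4)).
  assert (Hex : forall a b, 0 <= a -> 0 <= b -> ex_RInt f a b).
  { intros a b Ha Hb. apply (ex_RInt_continuous (V := R_CompleteNormedModule)).
    intros t [Ht _]. apply continuous_sq_mul_ln_div.
    refine (Rle_trans _ _ _ _ Ht). now apply Rmin_glb. }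
  assert (HC : RInt f 0 e + RInt f e 1 = RInt f 0 1)
    by (apply (RInt_Chasles (V := R_CompleteNormedModule)); apply Hex; lra).
  rewrite <- HC.
  replace (4 * (RInt f 0 e + RInt f e 1) - 4 * RInt f 0 e +
    2 * RInt (fun t => (1 - t ^ 2) / (1 + t ^ 4) * ln t) e 1) with
    (4 * RInt f e 1 + 2 * RInt (fun t => (1 - t ^ 2) / (1 + t ^ 4) * ln t) e 1) by ring.
  apply (is_RInt_unique (V := R_CompleteNormedModule)).
  apply (is_RInt_ext (fun t => plus (scal 4 (f t))
    (scal 2 ((1 - t ^ 2) / (1 + t ^ 4) * ln t)))).
  - intros t _. change (4 * f t + 2 * ((1 - t ^ 2) / (1 + t ^ 4) * ln t) = weight t * (2 * ln t)).
    unfold f, weight. assert (H := one_add_pow4_pos t). field. lra.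
  - apply (is_RInt_plus (V := R_NormedModule)); apply (is_RInt_scal (V := R_NormedModule));
      apply (RInt_correct (V := R_CompleteNormedModule)).
    + apply Hex; lra.
    + eexists. now apply RInt_one_minus_sq_mul_ln.
Qed.

Lemma is_lim_seq_weight_ln (d : nat -> R) :
  (forall n, 0 < d n <= 1) -> is_lim_seq d 0 ->
  is_lim_seq (fun n => RInt (fun x => weight x * (2 * ln x)) (d n ^ 2) 1)
    ((trigamma (7 / 8) - trigamma (3 / 8)) / 16 - PI ^ 2 / (4 * sqrt 2)).
Proof.
  intros Hd Hlim. assert (Hs := sqrt2_pos).
  assert (Hd2 : forall n, 0 < d n ^ 2 <= d n) by (intros n; specialize (Hd n); nra).
  apply (is_lim_seq_ext (fun n =>
    (trigamma (7 / 8) - trigamma (3 / 8)) / 16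
    - 4 * RInt (fun t => t ^ 2 * ln t / (1 + t ^ 4)) 0 (d n ^ 2)
    + 2 * RInt (fun t => (1 - t ^ 2) / (1 + t ^ 4) * ln t) (d n ^ 2) 1)).
  { intros n. rewrite RInt_weight_ln_split, RInt_sq_mul_ln_div; [field|].
    specialize (Hd n). specialize (Hd2 n). lra. }
  replace ((trigamma (7 / 8) - trigamma (3 / 8)) / 16 - PI ^ 2 / (4 * sqrt 2)) with
    ((trigamma (7 / 8) - trigamma (3 / 8)) / 16 - 4 * 0 + 2 * (- PI ^ 2 / (8 * sqrt 2)))
    by (field; lra).
  apply is_lim_seq_plus'; [apply is_lim_seq_minus'|].
  - apply is_lim_seq_const.
  - apply (is_lim_seq_scal_l _ 4 0).
    apply is_lim_seq_abs_le with d; [|exact Hlim].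
    intros n. rewrite Rminus_0_r. specialize (Hd n). specialize (Hd2 n).
    apply Rle_trans with ((d n ^ 2 - 0) * 1); [|lra].
    apply abs_RInt_le_const; [lra| |].
    + apply (ex_RInt_continuous (V := R_CompleteNormedModule)). intros t Ht.
      rewrite Rmin_left in Ht by lra. now apply continuous_sq_mul_ln_div.
    + intros t Ht. unfold Rdiv. rewrite Rabs_mult.
      assert (H1 := Rabs_pow_mul_ln_le 1 t). rewrite (Rabs_pos_eq t), pow_1 in H1 by lra.
      assert (Hp : 0 <= t ^ 4) by (apply pow_le; lra).
      assert (H2 : / (1 + t ^ 4) <= 1) by (rewrite <- Rinv_1; apply Rinv_le_contravar; lra).
      assert (H3 : 0 < / (1 + t ^ 4)) by (apply Rinv_0_lt_compat; lra).
      rewrite (Rabs_pos_eq (/ (1 + t ^ 4))) by lra.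
      assert (H4 : Rabs (t ^ 2 * ln t) <= 1) by (eapply Rle_trans; [apply H1|]; lra).
      assert (H5 := Rabs_pos (t ^ 2 * ln t)). nra.
  - apply (is_lim_seq_scal_l _ 2 (- PI ^ 2 / (8 * sqrt 2))).
    now apply is_lim_seq_one_minus_sq_mul_ln.
Qed.

(** Two evaluations of the limit of [rescaled_integral] at 0 are compared: its closed form is
    continuous in e and contains [base_integral], while the truncated logarithmic integral has a
    known limit. *)
Lemma base_integral_eq :
  base_integral = (trigamma (7 / 8) - trigamma (3 / 8)) / 16 - PI ^ 2 / (4 * sqrt 2)
    + PI / sqrt 2 * (3 / 2 * ln 2).
Proof.
  set (d := fun n => 1 / (2 + INR n)).
  assert (Hd : forall n, 0 < d n <= 1 / 2).
  { intros n. assert (Hn := pos_INR n). unfold d, Rdiv. rewrite !Rmult_1_l.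
    split; [apply Rinv_0_lt_compat; lra|apply Rinv_le_contravar; lra]. }
  assert (Hd1 : forall n, 0 < d n <= 1) by (intros n; specialize (Hd n); lra).
  assert (Hlim : is_lim_seq d 0) by apply is_lim_seq_inv_shift.
  assert (H1 := is_lim_seq_weight_ln d Hd1 Hlim).
  assert (H2 : is_lim_seq (fun n => rescaled_integral (d n ^ 2)
      - RInt (fun x => weight x * (2 * ln x)) (d n ^ 2) 1) 0).
  { apply is_lim_seq_abs_le with (fun n => 14 * d n).
    - intros n. rewrite Rminus_0_r. now apply rescaled_integral_approx.
    - replace (Finite 0) with (Rbar_mult 14 0) by (simpl; f_equal; ring).
      now apply is_lim_seq_scal_l. }
  assert (H3 := is_lim_seq_plus' _ _ _ _ H1 H2).
  assert (H4 : is_lim_seq (fun n => base_integral + PI / sqrt 2 * (ln (sqrt 2 * d n ^ 2 + 1) - 3 / 2 * ln 2))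
    (base_integral + PI / sqrt 2 * (ln (sqrt 2 * 0 ^ 2 + 1) - 3 / 2 * ln 2))).
  { apply (is_lim_seq_continuous
      (fun x => base_integral + PI / sqrt 2 * (ln (sqrt 2 * x ^ 2 + 1) - 3 / 2 * ln 2)) d 0); [|exact Hlim].
    apply ex_derive_continuity_pt. auto_derive. lra. }
  apply is_lim_seq_unique in H3. apply is_lim_seq_unique in H4.
  rewrite (Lim_seq_ext _ (fun n => base_integral
    + PI / sqrt 2 * (ln (sqrt 2 * d n ^ 2 + 1) - 3 / 2 * ln 2))), H4 in H3.
  - injection H3. replace (sqrt 2 * (0 * (0 * 1)) + 1) with 1 by ring. rewrite ln_1. simpl. lra.
  - intros n. rewrite rescaled_integral_eq by (specialize (Hd n); nra). ring.
Qed.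

Lemma is_RInt_weight_ln (a : R) : 0 < a ->
  is_RInt (fun x => weight x * ln ((1 - x ^ 2) ^ 2 + a ^ 2 * x ^ 2)) 0 1
    ((trigamma (7 / 8) - trigamma (3 / 8)) / 16 - PI ^ 2 / (4 * sqrt 2)
     + PI / sqrt 2 * ln (sqrt 2 + a)).
Proof.
  intros Ha.
  replace (_ + _) with (base_integral + PI / sqrt 2 * (ln (sqrt 2 + a) - 3 / 2 * ln 2))
    by (rewrite base_integral_eq; ring).
  now apply is_RInt_weight_ln_aux.
Qed.

(** * Pairing the factors *)

Lemma RInt_log_pow (m : nat) : (0 < m)%nat ->
  RInt (fun x => (x ^ 2 + 1) * ln (x ^ (4 * m) + 1) / (x ^ 4 + 1)) 0 1 =
  INR m / 16 * (trigamma (7 / 8) - trigamma (3 / 8)) - PI ^ 2 * INR m * sqrt 2 / 8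
  + PI * sqrt 2 / 2 * Rsum m (fun k => ln (sqrt 2 + 2 * sin (cheb_angle m k / 2))).
Proof.
  intros Hm. assert (Hs := sqrt2_pos). assert (Hss := sqrt2_sqr).
  set (g := fun k x => weight x * ln ((1 - x ^ 2) ^ 2 + (2 * sin (cheb_angle m k / 2)) ^ 2 * x ^ 2)).
  (* The induction is on the number n of factors with m fixed, because the angles depend on m. *)
  assert (Hg : forall n, (n <= m)%nat -> is_RInt (fun x => Rsum n (fun k => g k x)) 0 1
    (INR n * ((trigamma (7 / 8) - trigamma (3 / 8)) / 16 - PI ^ 2 / (4 * sqrt 2))
     + PI / sqrt 2 * Rsum n (fun k => ln (sqrt 2 + 2 * sin (cheb_angle m k / 2))))).
  { induction n as [|n IH]; intros Hn.
    - apply (is_RInt_ext (fun _ => 0)); [intros; now rewrite Rsum_0|].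
      rewrite Rsum_0. simpl INR.
      replace (_ + _) with (scal (1 - 0) 0) by (unfold scal; simpl; unfold mult; simpl; ring).
      apply (is_RInt_const (V := R_NormedModule)).
    - apply (is_RInt_ext (fun x => plus (Rsum n (fun k => g k x)) (g n x)));
        [intros; now rewrite Rsum_S|].
      assert (Ha : 0 < 2 * sin (cheb_angle m n / 2)).
      { assert (H := cheb_angle_bounds m n Hn). assert (HP := PI_RGT_0).
        assert (0 < cheb_angle m n).
        { assert (Hn0 := pos_INR n). apply lt_INR in Hm. simpl in Hm.
          unfold cheb_angle. apply Rdiv_lt_0_compat; nra. }
        assert (0 < sin (cheb_angle m n / 2)) by (apply sin_gt_0; lra). lra. }
      rewrite Rsum_S, S_INR.
      match goal with |- is_RInt _ _ _ ?A => replace A with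
        (plus (INR n * ((trigamma (7 / 8) - trigamma (3 / 8)) / 16 - PI ^ 2 / (4 * sqrt 2))
           + PI / sqrt 2 * Rsum n (fun k => ln (sqrt 2 + 2 * sin (cheb_angle m k / 2))))
          ((trigamma (7 / 8) - trigamma (3 / 8)) / 16 - PI ^ 2 / (4 * sqrt 2)
           + PI / sqrt 2 * ln (sqrt 2 + 2 * sin (cheb_angle m n / 2))))
        by (unfold plus; simpl; ring) end.
      apply (is_RInt_plus (V := R_NormedModule)); [apply IH; lia|].
      now apply is_RInt_weight_ln. }
  apply (is_RInt_unique (V := R_CompleteNormedModule)).
  apply (is_RInt_ext (fun x => Rsum m (fun k => g k x))).
  - intros x Hx. rewrite Rmin_left in Hx by lra.
    unfold g. rewrite Rsum_scal, <- ln_pow_mul_add_1 by (assumption || lra).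
    change (weight x * ln (x ^ (4 * m) + 1) = (x ^ 2 + 1) * ln (x ^ (4 * m) + 1) / (x ^ 4 + 1)).
    unfold weight, Rdiv. ring.
  - match goal with |- is_RInt _ _ _ ?A => replace A with
      (INR m * ((trigamma (7 / 8) - trigamma (3 / 8)) / 16 - PI ^ 2 / (4 * sqrt 2))
       + PI / sqrt 2 * Rsum m (fun k => ln (sqrt 2 + 2 * sin (cheb_angle m k / 2)))) end.
    + now apply Hg.
    + replace (PI / sqrt 2) with (PI * sqrt 2 / 2) by (field_simplify_eq [Hss]; lra).
      replace (PI ^ 2 / (4 * sqrt 2)) with (PI ^ 2 * sqrt 2 / 8) by (field_simplify_eq [Hss]; lra).
      field.
Qed.

(* For [0 < a < pi/2] and [q = sin a + cos a],
   [(sqrt 2 + 2 sin a) (sqrt 2 + 2 cos a) = 2 q (sqrt 2 + q)] and [q^2 = 1 + sin (2 a)]. *)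
Lemma ln_pair (m k : nat) : (2 * k + 1 < m)%nat ->
  ln (sqrt 2 + 2 * sin (cheb_angle m k / 2))
  + ln (sqrt 2 + 2 * sin (cheb_angle m (m - S k) / 2)) =
  ln 2 + / 2 * ln (1 + sqrt ((1 - phi m k) / 2))
  + ln (sqrt 2 + sqrt (1 + sqrt ((1 - phi m k) / 2))).
Proof.
  intros Hk. assert (HP := PI_RGT_0). assert (Hs := sqrt2_pos). assert (Hss := sqrt2_sqr).
  assert (Hk0 := pos_INR k).
  assert (Hm : 2 * INR k + 1 < INR m).
  { apply lt_INR in Hk. rewrite plus_INR, mult_INR in Hk. simpl in Hk. lra. }
  set (a := cheb_angle m k / 2).
  assert (Ha : 0 < a < PI / 4).
  { unfold a, cheb_angle. split; [apply Rdiv_lt_0_compat; [apply Rdiv_lt_0_compat|]; nra|].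
    apply Rmult_lt_reg_r with (4 * INR m); [lra|].
    replace ((2 * INR k + 1) * PI / (2 * INR m) / 2 * (4 * INR m)) with ((2 * INR k + 1) * PI)
      by (field; lra).
    replace (PI / 4 * (4 * INR m)) with (INR m * PI) by field. nra. }
  (* The reflected index has the complementary half-angle, so its sine is cos a. *)
  replace (cheb_angle m (m - S k) / 2) with (PI / 2 - a).
  2:{ unfold a, cheb_angle. rewrite minus_INR by lia. rewrite S_INR. field. lra. }
  rewrite sin_shift.
  assert (Hsin : 0 < sin a) by (apply sin_gt_0; lra).
  assert (Hcos : 0 < cos a) by (apply cos_gt_0; lra).
  assert (H1 := sin2_cos2 a). unfold Rsqr in H1.
  (* Since phi is cos (4 a), (1 - phi) / 2 is the square of sin (2 a). *)
  assert (Hphi : sqrt ((1 - phi m k) / 2) = 2 * sin a * cos a).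
  { unfold phi. replace ((2 * INR k + 1) * PI / INR m) with (2 * (2 * a))
      by (unfold a, cheb_angle; field; lra).
    rewrite cos_2a_sin, sin_2a.
    replace ((1 - (1 - 2 * (2 * sin a * cos a) * (2 * sin a * cos a))) / 2) with
      ((2 * sin a * cos a) * (2 * sin a * cos a)) by field.
    apply sqrt_square. nra. }
  rewrite Hphi. set (q := sin a + cos a).
  assert (Hqq : 1 + 2 * sin a * cos a = q * q) by (unfold q; nra).
  assert (Hq : 0 < q) by (unfold q; lra).
  rewrite Hqq, sqrt_square by lra.
  rewrite <- ln_mult by lra.
  replace ((sqrt 2 + 2 * sin a) * (sqrt 2 + 2 * cos a)) with (2 * (q * (sqrt 2 + q))).
  2:{ unfold q. ring_simplify. replace (sqrt 2 ^ 2) with 2 by (simpl; lra). simpl. lra. }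
  rewrite !ln_mult by (try apply Rmult_lt_0_compat; lra). field.
Qed.

(** Here c counts the middle factors left unpaired: 0 for even m, 1 for odd m. *)
Lemma Rsum_ln_pairs (m h c : nat) : (m = h + c + h)%nat ->
  Rsum m (fun k => ln (sqrt 2 + 2 * sin (cheb_angle m k / 2))) =
  Rsum c (fun k => ln (sqrt 2 + 2 * sin (cheb_angle m (h + k) / 2))) + INR h * ln 2
  + / 2 * (Rsum h (fun k => ln (1 + sqrt ((1 - phi m k) / 2)))
         + 2 * Rsum h (fun k => ln (sqrt 2 + sqrt (1 + sqrt ((1 - phi m k) / 2))))).
Proof.
  intros Em. set (f := fun k => ln (sqrt 2 + 2 * sin (cheb_angle m k / 2))).
  assert (E1 : Rsum m f = Rsum h f + Rsum c (fun k => f (h + k)%nat)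
    + Rsum h (fun k => f (h + c + k)%nat)) by (now rewrite Em at 1; rewrite !Rsum_split).
  assert (E2 : Rsum h (fun k => f (h + c + k)%nat) = Rsum h (fun k => f (m - S k)%nat)).
  { rewrite Rsum_rev. apply Rsum_ext. intros k Hkh. f_equal. lia. }
  assert (E3 : Rsum h f + Rsum h (fun k => f (m - S k)%nat) =
    Rsum h (fun k => ln 2 + / 2 * ln (1 + sqrt ((1 - phi m k) / 2))
      + ln (sqrt 2 + sqrt (1 + sqrt ((1 - phi m k) / 2))))).
  { rewrite <- Rsum_plus. apply Rsum_ext. intros k Hkh. apply ln_pair. lia. }
  assert (E4 : Rsum h (fun _ => ln 2) = INR h * ln 2).
  { clear. induction h as [|h IH]; [rewrite Rsum_0; simpl; ring|].
    rewrite Rsum_S, S_INR, IH. ring. }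
  rewrite !Rsum_plus, Rsum_scal, E4 in E3. rewrite E1, E2.
  change (Rsum c (fun k => ln (sqrt 2 + 2 * sin (cheb_angle m (h + k) / 2))))
    with (Rsum c (fun k => f (h + k)%nat)).
  lra.
Qed.

(* In the odd case the upper summation index (m - 3) / 2 is inclusive, so there
   are (m - 1) / 2 terms, and none for m = 1. *)
Theorem theorem2p7 :
  (forall m : nat, Nat.Even m -> (2 <= m)%nat ->
    RInt (fun x => (x ^ 2 + 1) * ln (x ^ (4 * m) + 1) / (x ^ 4 + 1)) 0 1 =
      INR m / 16 * (trigamma (7 / 8) - trigamma (3 / 8))
      - PI ^ 2 * INR m * sqrt 2 / 8
      + PI * INR m * sqrt 2 / 4 * ln 2
      + PI * sqrt 2 / 4 *
        (Rsum (m / 2) (fun k => ln (1 + sqrt ((1 - phi m k) / 2)))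
         + 2 * Rsum (m / 2) (fun k =>
             ln (sqrt 2 + sqrt (1 + sqrt ((1 - phi m k) / 2))))))
  /\
  (forall m : nat, Nat.Odd m -> (1 <= m)%nat ->
    RInt (fun x => (x ^ 2 + 1) * ln (x ^ (4 * m) + 1) / (x ^ 4 + 1)) 0 1 =
      INR m / 16 * (trigamma (7 / 8) - trigamma (3 / 8))
      - PI ^ 2 * INR m * sqrt 2 / 8
      + PI * (INR m + 2) * sqrt 2 / 4 * ln 2
      + PI * sqrt 2 / 4 *
        (Rsum ((m - 1) / 2) (fun k => ln (1 + sqrt ((1 - phi m k) / 2)))
         + 2 * Rsum ((m - 1) / 2) (fun k =>
             ln (sqrt 2 + sqrt (1 + sqrt ((1 - phi m k) / 2)))))).
Proof.
  split.
  - intros m [h Hh] Hm.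
    replace (m / 2)%nat with h by (rewrite Hh, Nat.mul_comm, Nat.div_mul; lia).
    rewrite RInt_log_pow by lia.
    rewrite (Rsum_ln_pairs m h 0) by lia. rewrite Rsum_0.
    replace (INR m) with (2 * INR h) by (rewrite Hh, mult_INR; reflexivity).
    apply Rminus_diag_uniq. field.
  - intros m [h Hh] Hm.
    replace ((m - 1) / 2)%nat with h
      by (rewrite Hh, Nat.add_sub, Nat.mul_comm, Nat.div_mul; lia).
    rewrite RInt_log_pow by lia.
    rewrite (Rsum_ln_pairs m h 1) by lia. rewrite Rsum_S, Rsum_0, Nat.add_0_r.
    assert (Em : INR m = 2 * INR h + 1) by (rewrite Hh, plus_INR, mult_INR; reflexivity).
    assert (Hh0 := pos_INR h). assert (Hs := sqrt2_pos). assert (Hss := sqrt2_sqr).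
    (* The middle factor contributes ln (2 sqrt 2) = (3/2) ln 2, and h + 3/2 = (m + 2) / 2 accounts
       for the m + 2 in the odd case. *)
    replace (cheb_angle m h / 2) with (PI / 4) by (unfold cheb_angle; rewrite Em; field; lra).
    replace (sqrt 2 + 2 * sin (PI / 4)) with (2 * sqrt 2)
      by (rewrite sin_PI4; field_simplify_eq [Hss]; lra).
    rewrite ln_mult by lra.
    assert (Hln : ln (sqrt 2) = / 2 * ln 2).
    { assert (H : ln (sqrt 2 * sqrt 2) = ln 2) by now rewrite Hss.
      rewrite ln_mult in H by assumption. lra. }
    rewrite Hln, Em. apply Rminus_diag_uniq. field.
Qed.
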